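(* Let $h>0$ be fixed, let $u_0,v_0\in L^1(\mathbb{R}^N)\cap L^\infty(\mathbb{R}^N)$ and let $f,g$ be measurable on $Q_T$ with $\int_0^T\big(\|f(\cdot,t)\|_{L^1(\mathbb{R}^N)}+\|f(\cdot,t)\|_{L^\infty(\mathbb{R}^N)}\big)dt<\infty$ and likewise for $g$. Assume that the scheme (S) is admissible (as defined in the context), and let $U_h^j,V_h^j\in L^1(\mathbb{R}^N)\cap L^\infty(\mathbb{R}^N)$ be the a.e.-solutions of (S) with data $(u_0,f)$ and $(v_0,g)$ respectively. Then for every $j\in\{1,\dots,J\}$, $$\int_{\mathbb{R}^N}(U_h^j-V_h^j)^+(x)\,dx\le\int_{\mathbb{R}^N}(u_0-v_0)^+(x)\,dx+\int_0^{t_j}\int_{\mathbb{R}^N}(f-g)^+(x,\tau)\,dx\,d\tau.$$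
   Context: Let $N\in\mathbb{N}$, $T>0$, $Q_T=\mathbb{R}^N\times(0,T)$, $a^+=\max\{a,0\}$. Operators: for a nonnegative symmetric (i.e. $\nu(-B)=\nu(B)$) Radon measure $\nu$ on $\mathbb{R}^N\setminus\{0\}$ with finite total mass, write $\mathcal{L}^\nu[\psi](x)=\int(\psi(x+z)-\psi(x))\,d\nu(z)$ and $\nu(\mathbb{R}^N)$ for the total mass. When $\psi$ is only defined a.e., a Borel representative is used. Time grid: $0=t_0<t_1<\dots<t_J=T$ (possibly nonuniform), $\Delta t_j=t_j-t_{j-1}$, $\Delta t=\max_j\Delta t_j$, and $F^j(x)=\frac1{\Delta t_j}\int_{t_{j-1}}^{t_j}f(x,t)\,dt$. Scheme (S) with data $(u_0,f)$: $U_h^0=u_0$ and, for $j=1,\dots,J$, for a.e. $x\in\mathbb{R}^N$, $$U_h^j(x)=U_h^{j-1}(x)+\Delta t_j\Big(\mathcal{L}^{\nu_1^h}[\varphi_1^h(U_h^j)](x)+\mathcal{L}^{\nu_2^h}[\varphi_2^h(U_h^{j-1})](x)+F^j(x)\Big).$$ The scheme is called admissible if: $\nu_1^h,\nu_2^h$ are nonnegative symmetric Radon measures on $\mathbb{R}^N\setminus\{0\}$ with finite total mass; $\varphi_1^h:\mathbb{R}\to\mathbb{R}$ is nondecreasing and continuous; $\varphi_2^h:\mathbb{R}\to\mathbb{R}$ is nondecreasing and locally Lipschitz; and the CFL condition $\Delta t\,L_{\varphi_2^h}\,\nu_2^h(\mathbb{R}^N)\le1$ holds, where $L_{\varphi_2^h}$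 is the Lipschitz constant of $\varphi_2^h$ on $[-M,M]$, and $M$ is the larger of $\|u_0\|_{L^\infty}+\int_0^T\|f(\cdot,\tau)\|_{L^\infty}d\tau$ and $\|v_0\|_{L^\infty}+\int_0^T\|g(\cdot,\tau)\|_{L^\infty}d\tau$. *)

(* Defs.v *)
From HB Require Import structures.
From mathcomp Require Import all_boot all_order all_algebra.
From mathcomp Require Import all_classical all_reals all_analysis.

Set Implicit Arguments.
Unset Strict Implicit.
Unset Printing Implicit Defensive.

Import Order.TTheory GRing.Theory Num.Theory.
Import numFieldNormedType.Exports.

Local Open Scope classical_set_scope.
Local Open Scope ring_scope.

(* The sigma-algebra on R^n is generated by the coordinates (as the library does
   for n.-tuple); over the reals it is the Borel sigma-algebra of R^n. *)
Section measurable_rV.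
Variables (R : realType) (n : nat).

Definition rV_coord (i : 'I_n) (x : 'rV[R]_n) : R := x 0 i.

Let rV_set0 : g_sigma_preimage rV_coord set0.
Proof. exact: sigma_algebra0. Qed.

Let rV_setC A : g_sigma_preimage rV_coord A -> g_sigma_preimage rV_coord (~` A).
Proof. exact: sigma_algebraC. Qed.

Let rV_bigcup (F : (set 'rV[R]_n)^nat) :
  (forall i, g_sigma_preimage rV_coord (F i)) ->
  g_sigma_preimage rV_coord (\bigcup_i F i).
Proof. exact: sigma_algebra_bigcup. Qed.

HB.instance Definition _ := @isMeasurable.Build default_measure_display
  'rV[R]_n (g_sigma_preimage rV_coord) rV_set0 rV_setC rV_bigcup.

Lemma measurable_rV_coord i : measurable_fun [set: 'rV[R]_n] (rV_coord i).
Proof.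
move=> _ Y mY; rewrite setTI; apply: sub_sigma_algebra.
rewrite -bigcup_seq/=; exists i => /=; first by rewrite mem_index_enum.
by exists Y => //; rewrite setTI.
Qed.

Lemma measurable_fun_rVP d (T : measurableType d) (f : T -> 'rV[R]_n) :
  (forall i, measurable_fun [set: T] (fun x => f x 0 i)) ->
  measurable_fun [set: T] f.
Proof.
move=> mf _ A mA; rewrite setTI.
have : preimage_set_system setT f (g_sigma_preimage rV_coord) (f @^-1` A).
  by exists A => //; rewrite setTI.
rewrite -g_sigma_preimage_comp; move: (f @^-1` A).
apply: smallest_sub; first exact: sigma_algebra_measurable.
rewrite -bigcup_seq; apply: bigcup_sub => i _ B [C mC <-].
exact: mf.
Qed.

End measurable_rV.

Section lebesgue_rV.
Variable R : realType.

Definition rV_cons n (p : R * 'rV[R]_n) : 'rV[R]_n.+1 := row_mx p.1%:M p.2.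

Definition rV_uncons n (x : 'rV[R]_n.+1) : R * 'rV[R]_n :=
  (x 0 0, rsubmx (x : 'rV[R]_(1 + n))).

Lemma rV_cons0 n p : @rV_cons n p 0 0 = p.1.
Proof.
rewrite (_ : 0 = lshift n (0 : 'I_1) :> 'I_(1 + n)); last exact/val_inj.
by rewrite [LHS]row_mxEl mxE mulr1n.
Qed.

Lemma rV_consS n p i : @rV_cons n p 0 (lift 0 i) = p.2 0 i.
Proof.
rewrite (_ : lift 0 i = rshift 1 i :> 'I_(1 + n)); last exact/val_inj.
by rewrite [LHS]row_mxEr.
Qed.

Lemma rV_consK n : cancel (@rV_cons n) (@rV_uncons n).
Proof. by move=> [a v]; rewrite /rV_uncons rV_cons0 /rV_cons row_mxKr. Qed.

Lemma measurable_rV_cons n : measurable_fun [set: R * 'rV[R]_n] (@rV_cons n).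
Proof.
apply: measurable_fun_rVP => i.
have [j ->|->] := unliftP 0 i.
  under eq_fun do rewrite rV_consS.
  exact: (measurableT_comp (measurable_rV_coord j) measurable_snd).
under eq_fun do rewrite rV_cons0.
exact: measurable_fst.
Qed.

Lemma measurable_rV_uncons n :
  measurable_fun [set: 'rV[R]_n.+1] (@rV_uncons n).
Proof.
apply: measurable_fun_pair => /=; first exact: (measurable_rV_coord (ord0 : 'I_n.+1)).
apply: measurable_fun_rVP => i.
under eq_fun do rewrite mxE.
exact: (@measurable_rV_coord _ n.+1 (rshift 1 i : 'I_(1 + n))).
Qed.

(* Lebesgue measure on R^(n+1) is the product of Lebesgue measure on R with
   Lebesgue measure on R^n, carried over by (a, v) |-> (a, v_0, ..., v_(n-1)). *)
Section lebesgue_rV_step.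
Variables (n : nat) (mu : {sigma_finite_measure set 'rV[R]_n -> \bar R}).

Definition lebesgue_rV_step : set 'rV[R]_n.+1 -> \bar R :=
  pushforward (@lebesgue_measure R \x mu)%E (@rV_cons n).

Let step0 : lebesgue_rV_step set0 = 0%E.
Proof. by rewrite /lebesgue_rV_step /pushforward preimage_set0 measure0. Qed.

Let step_ge0 A : (0 <= lebesgue_rV_step A)%E.
Proof. by rewrite /lebesgue_rV_step /pushforward; exact: measure_ge0. Qed.

Let step_sigma_additive : semi_sigma_additive lebesgue_rV_step.
Proof.
move=> F mF tF mUF; rewrite /lebesgue_rV_step /pushforward preimage_bigcup.
apply: measure_semi_sigma_additive.
- by move=> k; rewrite -[X in measurable X]setTI; exact: measurable_rV_cons.
- apply/trivIsetP => /= i j _ _ ij; rewrite -preimage_setI.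
  by move/trivIsetP : tF => /(_ _ _ _ _ ij) ->//; rewrite preimage_set0.
- rewrite -preimage_bigcup -[X in measurable X]setTI.
  exact: measurable_rV_cons.
Qed.

HB.instance Definition _ := isMeasure.Build _ _ _ lebesgue_rV_step
  step0 step_ge0 step_sigma_additive.

Let step_sigma_finite : sigma_finite setT lebesgue_rV_step.
Proof.
have /sigma_finiteP[F [TF ndF Foo]] := sigma_finiteT (@lebesgue_measure R).
have /sigma_finiteP[G [TG ndG Goo]] := sigma_finiteT mu.
exists (fun k => @rV_uncons n @^-1` (F k `*` G k)).
  rewrite -preimage_bigcup -[LHS](preimage_setT (@rV_uncons n)); congr (_ @^-1` _).
  rewrite -setXTT TF TG predeqE => -[x y]; split.
    move=> [/= [k _ Fkx] [l _ Gly]]; exists (maxn k l) => //; split.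
    - by move: x Fkx; exact/subsetPset/ndF/leq_maxl.
    - by move: y Gly; exact/subsetPset/ndG/leq_maxr.
  by move=> [k _ []/= ? ?]; split; exists k.
move=> k; have [mF Fk] := Foo k; have [mG Gk] := Goo k; split.
  rewrite -[X in measurable X]setTI; apply: measurable_rV_uncons => //.
  exact: measurableX.
rewrite /lebesgue_rV_step /pushforward -comp_preimage.
rewrite (_ : _ \o _ = id); last by apply/funext => p; exact: rV_consK.
by rewrite preimage_id product_measure1E// lte_mul_pinfty// ge0_fin_numE.
Qed.

HB.instance Definition _ := Measure_isSigmaFinite.Build _ _ _ lebesgue_rV_step
  step_sigma_finite.

End lebesgue_rV_step.

Fixpoint lebesgue_rV n : {sigma_finite_measure set 'rV[R]_n -> \bar R} :=
  match n with
  | 0 => \d_(0 : 'rV[R]_0)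
  | k.+1 => lebesgue_rV_step (lebesgue_rV k)
  end.

Lemma lebesgue_rV_box n (A : 'I_n -> set R) :
  (forall i, measurable (A i)) ->
  lebesgue_rV n [set x | forall i, A i (x 0 i)] =
  (\prod_(i < n) lebesgue_measure (A i))%E.
Proof.
elim: n A => [|n IHn] A mA.
  rewrite big_ord0 /= diracE mem_set//= => -[].
  by case.
rewrite big_ord_recl -IHn; last by move=> i; exact: mA.
have mB : measurable [set x : 'rV[R]_n | forall i, A (lift 0 i) (x 0 i)].
  rewrite (_ : [set _ | _] = \bigcap_(i in [set: 'I_n])
      (rV_coord i @^-1` A (lift 0 i))); last first.
    by apply/seteqP; split => [x xA i _|x xA i]; [exact: (xA i)|exact: (xA i I)].
  apply: fin_bigcap_measurable => // i _.
  by rewrite -[X in measurable X]setTI; exact: measurable_rV_coord.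
rewrite -product_measure1E//; last exact: mA.
rewrite /= /lebesgue_rV_step /pushforward.
set B := (X in _ = _ X); rewrite (_ : _ @^-1` _ = B)//.
apply/seteqP; split => [p pA|p [p0 pS] i] /=.
  split=> [|i /=]; first by have := pA 0; rewrite rV_cons0.
  by have := pA (lift 0 i); rewrite rV_consS.
have [j ->|->] := unliftP 0 i; first by rewrite rV_consS; exact: pS.
by rewrite rV_cons0.
Qed.

End lebesgue_rV.

Section scheme.
Variables (R : realType) (N : nat).

Local Notation leb := (lebesgue_rV R N).

(* A finite Borel measure on R^N \ {0} (finiteness makes it Radon) is encoded as
   its extension by zero, i.e. a finite measure on R^N that does not charge 0. *)
Definition symmetric_levy_measure
    (nu : {finite_measure set 'rV[R]_N -> \bar R}) : Prop :=
  nu [set 0] = 0%E /\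
  forall B : set 'rV[R]_N, measurable B -> nu [set - z | z in B] = nu B.

Definition levy_op (nu : {finite_measure set 'rV[R]_N -> \bar R})
    (psi : 'rV[R]_N -> R) (x : 'rV[R]_N) : R :=
  \int[nu]_z (psi (x + z) - psi x).

Definition L1_Linfty (u : 'rV[R]_N -> R) : Prop :=
  u \in Lfun leb 1%E /\ u \in Lfun leb +oo%E.

Definition source_condition (T : R) (f : 'rV[R]_N * R -> R) : Prop :=
  measurable_fun (setT `*` `]0, T[) f /\
  (\int[lebesgue_measure]_(t in `]0%R, T[)
     ('N[leb]_1[EFin \o (fun x => f (x, t))] +
      'N[leb]_+oo[EFin \o (fun x => f (x, t))]) < +oo)%E.

Definition data_bound (T : R) (u : 'rV[R]_N -> R) (f : 'rV[R]_N * R -> R) :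
    \bar R :=
  ('N[leb]_+oo[EFin \o u] +
   \int[lebesgue_measure]_(t in `]0%R, T[)
     'N[leb]_+oo[EFin \o (fun x => f (x, t))])%E.

Definition locally_lipschitz (phi : R -> R) : Prop :=
  forall x : R, exists2 A, nbhs x A & [lipschitz phi y | y in A].

Definition lipschitz_constant (phi : R -> R) (A : set R) : R :=
  inf [set k | 0 <= k /\ k.-lipschitz_A phi].

Definition time_grid (T : R) (J : nat) (t : nat -> R) : Prop :=
  [/\ t 0%N = 0, t J = T & forall j, (j < J)%N -> t j < t j.+1].

Definition time_step (t : nat -> R) (j : nat) : R := t j - t j.-1.

Definition max_time_step (J : nat) (t : nat -> R) : R :=
  \big[Num.max/0]_(1 <= j < J.+1) time_step t j.

Definition source_average (t : nat -> R) (f : 'rV[R]_N * R -> R) (j : nat)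
    (x : 'rV[R]_N) : R :=
  (time_step t j)^-1 *
  \int[lebesgue_measure]_(s in `]t j.-1, t j[) f (x, s).

Definition admissible (T : R) (J : nat) (t : nat -> R)
    (nu1 nu2 : {finite_measure set 'rV[R]_N -> \bar R}) (phi1 phi2 : R -> R)
    (u0 v0 : 'rV[R]_N -> R) (f g : 'rV[R]_N * R -> R) : Prop :=
  let M := fine (maxe (data_bound T u0 f) (data_bound T v0 g)) in
  [/\ symmetric_levy_measure nu1 /\ symmetric_levy_measure nu2,
      {homo phi1 : x y / x <= y} /\ continuous phi1,
      {homo phi2 : x y / x <= y} /\ locally_lipschitz phi2 &
      max_time_step J t * lipschitz_constant phi2 `[- M, M]
        * fine (nu2 setT) <= 1].

(* Functions stand for their a.e. classes, hence the initial condition, like the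
   scheme itself, is only required a.e.; j.-1 is used for j >= 1 only. *)
Definition ae_solution (J : nat) (t : nat -> R)
    (nu1 nu2 : {finite_measure set 'rV[R]_N -> \bar R}) (phi1 phi2 : R -> R)
    (u0 : 'rV[R]_N -> R) (f : 'rV[R]_N * R -> R) (U : nat -> 'rV[R]_N -> R) :
    Prop :=
  [/\ forall j, (j <= J)%N -> L1_Linfty (U j),
      {ae leb, forall x, U 0%N x = u0 x} &
      forall j, (1 <= j <= J)%N -> {ae leb, forall x,
        U j x = U j.-1 x + time_step t j *
          (levy_op nu1 (phi1 \o U j) x + levy_op nu2 (phi2 \o U j.-1) x
           + source_average t f j x)}].

End scheme.

(* Main.v *)
(** The nonlinearity phi1 is merely continuous, so phi1(U) - phi1(V) need not be
    integrable and Kato's inequality is not directly available. With w = U - V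
    and psi = phi1(U) - phi1(V), put theta = psi + d w for small d > 0: then
    {theta > 0} = {w > 0}, and p = (theta - d^2)^+ is integrable because psi is
    bounded and small wherever U and V are. On {theta > d^2}, L psi is at most
    L p plus d times an integrable error, while L p >= 0 elsewhere. Since the
    Lebesgue integral of L p vanishes by translation invariance, integrating the
    scheme and letting d -> 0 bounds the integral of w^+ by that of the positive
    part of the explicit terms. Under the CFL condition the explicit operator is
    monotone and has the same property. The CFL condition only controls phi2 on
    [-M, M], which is why an L^infinity bound is needed first: it follows from
    the explicit monotonicity and, for the implicit part, from evaluating the
    scheme near the essential supremum of U. *)

Require Import Defs.
From HB Require Import structures.
From mathcomp Require Import all_boot all_order all_algebra.
From mathcomp Require Import all_classical all_reals all_analysis.
From mathcomp Require Import measurable_realfun ess_sup_inf ring lra.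

Set Implicit Arguments.
Unset Strict Implicit.
Unset Printing Implicit Defensive.

Import Order.TTheory GRing.Theory Num.Theory.
Import numFieldNormedType.Exports.

Local Open Scope classical_set_scope.
Local Open Scope ring_scope.

(** * Translation invariance *)

(** The preimage of []b, c]] is []b - a, c - a]], of the same length, and Lebesgue measure is
    determined by its values on such intervals. *)
Lemma lebesgue_measure_shift (R : realType) (a : R) (A : set R) :
  measurable A ->
  pushforward (@lebesgue_measure R)
    ((fun x => x + a) : _ -> measurableTypeR R) A = lebesgue_measure A.
Proof.
move=> mA.
have ms : measurable_fun setT ((fun x => x + a) : R -> measurableTypeR R).
  exact: measurable_funD.
apply/esym/lebesgue_measure_unique => //= _ [[b c]] _ <-.
rewrite /pushforward (_ : _ @^-1` _ = `]b - a, c - a]%classic); last first.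
  by apply/seteqP; split=> x /=; rewrite !in_itv/= ltrBlDr lerBrDr.
by rewrite !lebesgue_measure_itv/= !lte_fin ltrD2r !EFinB; case: ifP => // _;
  rewrite -!EFinD; congr EFin; lra.
Qed.

Lemma ge0_integral_lebesgue_shift (R : realType) (a : R) (h : R -> \bar R) :
  measurable_fun setT h -> (forall x, 0 <= h x)%E ->
  (\int[@lebesgue_measure R]_x h (x + a)%R = \int[lebesgue_measure]_x h x)%E.
Proof.
move=> mh h0.
have ms : measurable_fun setT ((fun x => x + a) : R -> measurableTypeR R).
  exact: measurable_funD.
transitivity (\int[pushforward (@lebesgue_measure R)
    ((fun x => (x + a)%R) : _ -> measurableTypeR R)]_x h x)%E.
  by rewrite ge0_integral_pushforward.
apply: eq_measure_integral => A mA _.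
exact: lebesgue_measure_shift.
Qed.

Section translation.
Variables (R : realType).

Lemma measurable_rV_add N :
  measurable_fun setT (fun p : 'rV[R]_N * 'rV[R]_N => p.1 + p.2).
Proof.
apply: measurable_fun_rVP => i; under eq_fun do rewrite mxE.
apply: measurable_funD.
- exact: (measurableT_comp (measurable_rV_coord i) measurable_fst).
- exact: (measurableT_comp (measurable_rV_coord i) measurable_snd).
Qed.

Lemma measurable_rV_shift N (z : 'rV[R]_N) :
  measurable_fun setT (fun x : 'rV[R]_N => x + z).
Proof. exact: (measurableT_comp (@measurable_rV_add N) (pair2_measurable z)). Qed.

Lemma rV_cons_add N (a b : R) (v w : 'rV[R]_N) :
  rV_cons (a + b, v + w) = rV_cons (a, v) + rV_cons (b, w).
Proof. by rewrite /rV_cons /= raddfD -add_row_mx. Qed.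

Lemma rV_unconsK N : cancel (@rV_uncons R N) (@rV_cons R N).
Proof.
move=> x; apply/rowP => i; have [j ->|->] := unliftP 0 i.
  by rewrite rV_consS /= mxE; congr (x _ _); exact/val_inj.
by rewrite rV_cons0.
Qed.

(** Induction on the dimension: Tonelli isolates the first coordinate, the induction hypothesis
    absorbs the shift of the others, and the one-dimensional case that of the first. *)
Lemma ge0_integral_rV_shift N (z : 'rV[R]_N) (h : 'rV[R]_N -> \bar R) :
  measurable_fun setT h -> (forall x, 0 <= h x)%E ->
  (\int[lebesgue_rV R N]_x h (x + z)%R = \int[lebesgue_rV R N]_x h x)%E.
Proof.
elim: N z h => [|N IH] z h mh h0.
  by apply: eq_integral => x _; congr h; rewrite thinmx0 [RHS]thinmx0.
have mc := @measurable_rV_cons R N.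
have mhz : measurable_fun setT (fun x : 'rV[R]_N.+1 => h (x + z)).
  exact: (measurableT_comp mh (measurable_rV_shift z)).
have mhc : measurable_fun setT (h \o @rV_cons R N) by exact: measurableT_comp.
have mhzc : measurable_fun setT ((fun x : 'rV[R]_N.+1 => h (x + z)) \o @rV_cons R N).
  exact: measurableT_comp.
have E g : measurable_fun setT g -> (forall x, 0 <= g x)%E ->
  (\int[lebesgue_rV R N.+1]_x g x = \int[lebesgue_measure]_a
     \int[lebesgue_rV R N]_v g (rV_cons (a, v)))%E.
  move=> mg g0.
  (* By computation: [lebesgue_rV R N.+1] unfolds to this pushforward. *)
  transitivity (\int[pushforward (@lebesgue_measure R \x lebesgue_rV R N)%E
      (@rV_cons R N)]_x g x)%E; first by [].
  rewrite ge0_integral_pushforward// preimage_setT fubini_tonelli1//=.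
  exact: measurableT_comp.
rewrite !E//.
have := rV_unconsK z.
case: (rV_uncons z) => b' w' zE.
transitivity (\int[@lebesgue_measure R]_a
    ((fun a => \int[lebesgue_rV R N]_v h (rV_cons (a, v))) (a + b')%R))%E.
  apply: eq_integral => a _.
  rewrite -(IH w' (fun v => h (rV_cons (a + b', v))))//.
    by apply: eq_integral => v _; rewrite -zE -rV_cons_add.
  exact: (measurableT_comp mhc (pair1_measurable (a + b'))).
apply: (@ge0_integral_lebesgue_shift R b'
    (fun a => \int[lebesgue_rV R N]_v h (rV_cons (a, v)))%E).
  by apply: (measurable_fun_fubini_tonelli_F (h \o @rV_cons R N)) => // p; exact: h0.
by move=> a; apply: integral_ge0 => v _; exact: h0.
Qed.

(** Essential suprema are meaningful only on a space of positive mass: this makes those of bounded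
    functions finite and lets the L^infinity norm unfold to one. *)
Lemma lebesgue_rV_setT_gt0 N : (0 < lebesgue_rV R N setT)%E.
Proof.
have := @lebesgue_rV_box R N (fun=> setT) (fun=> measurableT).
rewrite (_ : [set x | _] = setT); last by apply/seteqP; split.
move=> ->; apply: (big_ind (fun x : \bar R => 0 < x)%E) => [|x y|i _].
- exact: lte01.
- exact: mule_gt0.
- by rewrite -set_itvNyy lebesgue_measure_itv/= addye// lt0y.
Qed.

End translation.

(** * Levy operators of finite measures *)

Section levy.
Variables (R : realType) (N : nat).
Variable nu : {finite_measure set 'rV[R]_N -> \bar R}.

Local Notation leb := (lebesgue_rV R N).

Lemma measurable_int_rV_add (h : 'rV[R]_N -> \bar R) :
  measurable_fun setT h -> (forall x, 0 <= h x)%E ->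
  measurable_fun setT (fun x : 'rV[R]_N => \int[nu]_z h (x + z)%R)%E.
Proof.
move=> mh h0.
apply: (measurable_fun_fubini_tonelli_F (fun p : 'rV[R]_N * 'rV[R]_N => h (p.1 + p.2))).
- exact: (measurableT_comp mh (@measurable_rV_add R N)).
- by move=> p; exact: h0.
Qed.

(** Tonelli, then translation invariance in [x]. This is how the vanishing integral of a Levy
    operator enters: the gain term, the [nu]-integral of [p (x + z)], and the loss term
    [nu setT * p x] have equal integrals. *)
Lemma ge0_integral_rV_add (h : 'rV[R]_N -> \bar R) :
  measurable_fun setT h -> (forall x, 0 <= h x)%E ->
  (\int[leb]_x \int[nu]_z h (x + z)%R = nu setT * \int[leb]_x h x)%E.
Proof.
move=> mh h0.
rewrite (fubini_tonelli (fun p : 'rV[R]_N * 'rV[R]_N => h (p.1 + p.2)%R))/=.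
- under eq_integral do rewrite ge0_integral_rV_shift//.
  rewrite muleC -[RHS]integral_cst//.
- exact: (measurableT_comp mh (@measurable_rV_add R N)).
- by move=> p; exact: h0.
Qed.

(** The previous identity, applied to the indicator of a null set, shows that almost all of its
    translates are [nu]-null. Hence [levy_op] respects almost everywhere equality. *)
Lemma ae_rV_add (P : 'rV[R]_N -> Prop) :
  {ae leb, forall x, P x} -> {ae leb, forall x, {ae nu, forall z, P (x + z)}}.
Proof.
move=> [A [mA A0 PA]].
have mI : measurable_fun setT (EFin \o (\1_A : 'rV[R]_N -> R)).
  exact/measurable_EFinP/measurable_indic.
have I0 x : (0 <= (EFin \o (\1_A : 'rV[R]_N -> R)) x)%E by rewrite lee_fin.
have := ge0_integral_rV_add mI I0.
have -> : (\int[leb]_x (EFin \o (\1_A : 'rV[R]_N -> R)) x = 0)%E.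
  by rewrite integral_indic// setIT.
rewrite mule0 => I.
have : {ae leb, forall x, (\int[nu]_z (\1_A (x + z))%:E = 0)%E}.
  have := ae_eq_integral_abs leb measurableT (measurable_int_rV_add mI I0).
  move=> [+ _].
  under eq_integral do rewrite gee0_abs ?integral_ge0//.
  by move=> /(_ I); apply: filterS => x /(_ Logic.I).
apply: filterS => x x0.
exists ((fun z => x + z) @^-1` A).
have mxA : measurable ((fun z => x + z) @^-1` A).
  rewrite -[X in measurable X]setTI.
  exact: (measurableT_comp (@measurable_rV_add R N) (pair1_measurable x)).
split => //; last by move=> z; exact: PA.
rewrite -(setIT (_ @^-1` _)) -integral_indic//.
Qed.

Lemma finite_measure_integrable_bounded (psi : 'rV[R]_N -> R) (B : R) :
  measurable_fun setT psi -> (forall z, `|psi z| <= B) ->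
  nu.-integrable setT (EFin \o psi).
Proof.
move=> mpsi psiB; apply: measurable_bounded_integrable => //.
- by rewrite ltey_eq fin_num_measure.
- exists B; split; first exact: num_real.
  by move=> y By x _ /=; rewrite (le_trans (psiB x))// ltW.
Qed.

Lemma levy_op_ae (psi psi' : 'rV[R]_N -> R) :
  measurable_fun setT psi -> measurable_fun setT psi' ->
  {ae leb, forall x, psi x = psi' x} ->
  {ae leb, forall x, levy_op nu psi x = levy_op nu psi' x}.
Proof.
move=> mpsi mpsi' E; have := ae_rV_add E.
move: E; apply: filterS2 => x xE xzE.
have ms := measurableT_comp (@measurable_rV_add R N) (pair1_measurable x).
congr fine; apply: ae_eq_integral => //.
- apply/measurable_EFinP/measurable_funB => //.
  exact: measurableT_comp mpsi ms.
- apply/measurable_EFinP/measurable_funB => //.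
  exact: measurableT_comp mpsi' ms.
- by apply: filterS xzE => z zE _; rewrite zE xE.
Qed.

End levy.

(** * Contraction for the implicit part *)

Section implicit_step.
Variables (R : realType) (N : nat).
Variable nu : {finite_measure set 'rV[R]_N -> \bar R}.

Local Notation leb := (lebesgue_rV R N).

Lemma EFin_Rintegral_bounded (psi : 'rV[R]_N -> R) (B : R) :
  measurable_fun setT psi -> (forall z, `|psi z| <= B) ->
  ((\int[nu]_z psi z)%:E = \int[nu]_z (psi z)%:E)%E.
Proof.
move=> mpsi psiB; rewrite fineK//; apply: integrable_fin_num => //.
exact: finite_measure_integrable_bounded psiB.
Qed.

Lemma measurable_comp_rV_add (psi : 'rV[R]_N -> R) (x : 'rV[R]_N) :
  measurable_fun setT psi -> measurable_fun setT (fun z => psi (x + z)).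
Proof.
move=> mpsi; apply: (measurableT_comp mpsi).
exact: (measurableT_comp (@measurable_rV_add R N) (pair1_measurable x)).
Qed.

Lemma levy_op_bounded (psi : 'rV[R]_N -> R) (B : R) (x : 'rV[R]_N) :
  measurable_fun setT psi -> (forall z, `|psi z| <= B) ->
  levy_op nu psi x = \int[nu]_z psi (x + z) - psi x * fine (nu setT).
Proof.
move=> mpsi psiB; rewrite /levy_op RintegralB//.
- by rewrite Rintegral_cst.
- apply: (@finite_measure_integrable_bounded _ _ _ _ B) => //.
  exact: measurable_comp_rV_add.
- exact: finite_measure_integrable_cst.
Qed.

(** Everywhere [psi + d * w - e <= p], with equality at [x], where the truncation is inactive. On
    subtracting, [e] cancels, so the increment of [psi] is at most that of [p] plus
    [d * (|w (x + z)| + |w x|)]. *)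
Lemma le_levy_op_truncation (w psi : 'rV[R]_N -> R) (p : 'rV[R]_N -> R) (B d e : R)
    (x : 'rV[R]_N) :
  measurable_fun setT w -> measurable_fun setT psi ->
  (forall z, `|w z| <= B) -> (forall z, `|psi z| <= B) ->
  0 <= d -> 0 <= e ->
  p = (fun z => Num.max (psi z + d * w z - e) 0) ->
  e < psi x + d * w x ->
  levy_op nu psi x + p x * fine (nu setT) <=
  \int[nu]_z p (x + z) +
  d * (\int[nu]_z `|w (x + z)| + `|w x| * fine (nu setT)).
Proof.
move=> mw mpsi wB psiB d0 e0 pE ex.
have mp : measurable_fun setT p.
  rewrite pE.
  apply: measurable_maxr => //; apply: measurable_funB => //.
  apply: measurable_funD => //.
  exact: measurable_funM.
have mw' := measurable_comp_rV_add x mw.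
have pB z : `|p z| <= B + d * B.
  have := psiB z; have := wB z; rewrite !ler_norml pE => /andP[w1 w2] /andP[p1 p2].
  have dw := ler_wpM2l d0 w2; have dw' := ler_wpM2l d0 w1.
  by case: (leP (psi z + d * w z - e) 0); nra.
have ip : nu.-integrable setT (EFin \o (fun z => p (x + z))).
  apply: (@finite_measure_integrable_bounded _ _ _ _ (B + d * B)) => //.
  exact: measurable_comp_rV_add.
have iw : nu.-integrable setT (EFin \o (fun z => `|w (x + z)|)).
  apply: (@finite_measure_integrable_bounded _ _ _ _ B) => //.
    exact: measurableT_comp.
  by move=> z; rewrite normr_id.
have idw : nu.-integrable setT (EFin \o (fun z => d * `|w (x + z)|)).
  exact: (integrableZl measurableT d iw).
have icst c : nu.-integrable setT (EFin \o cst c).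
  exact: finite_measure_integrable_cst.
have ipdw : nu.-integrable setT
    (EFin \o (fun z => p (x + z) + d * `|w (x + z)|)).
  exact: (integrableD measurableT ip idw).
rewrite -lerBrDr; apply: (@le_trans _ _ (\int[nu]_z
    (p (x + z) + d * `|w (x + z)| + (d * `|w x| - p x)))).
  apply: le_Rintegral => //.
  - apply: (@finite_measure_integrable_bounded _ _ _ _ (B + B)).
      apply: measurable_funB => //.
      exact: measurable_comp_rV_add.
    by move=> z; rewrite (le_trans (ler_normB _ _))// lerD.
  - exact: (integrableD measurableT ipdw (icst _)).
  - move=> z _; rewrite pE (@max_l _ _ (_ x + _ - e)); last by lra.
    have h1 := ler_norm (- w (x + z)); have h2 := ler_norm (w x).
    rewrite normrN in h1.
    have dw := ler_wpM2l d0 h1; have dw' := ler_wpM2l d0 h2.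
    case: (leP (psi (x + z) + d * w (x + z) - e) 0); lra.
have -> : \int[nu]_z (p (x + z) + d * `|w (x + z)| + (d * `|w x| - p x)) =
    \int[nu]_z p (x + z) + d * \int[nu]_z `|w (x + z)| +
    (d * `|w x| - p x) * fine (nu setT).
  rewrite (RintegralD measurableT ipdw (icst (d * `|w x| - p x))).
  by rewrite (RintegralD measurableT ip idw) RintegralZl// Rintegral_cst.
by rewrite le_eqVlt; apply/orP; left; apply/eqP; ring.
Qed.

(* The constant d^2 makes [w x > d] imply [psi x + d * w x > d^2], so that
   [(w - d)^+] is supported where the truncated function is positive. *)
Lemma implicit_step (w psi : 'rV[R]_N -> R) (q : 'rV[R]_N -> \bar R)
    (tau B : R) :
  0 <= tau ->
  measurable_fun setT w -> measurable_fun setT psi -> measurable_fun setT q ->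
  (forall x, (0 <= q x)%E) ->
  (forall z, `|w z| <= B) -> (forall z, `|psi z| <= B) ->
  leb.-integrable setT (EFin \o w) ->
  (forall x, 0 < w x -> 0 <= psi x) -> (forall x, w x <= 0 -> psi x <= 0) ->
  (forall e : R, (0 < e)%R -> \int[leb]_x (Num.max (psi x - e) 0)%:E < +oo)%E ->
  {ae leb, forall x, (w x)%:E <= (tau * levy_op nu psi x)%:E + q x}%E ->
  (\int[leb]_x (Num.max (w x) 0)%:E <= \int[leb]_x q x)%E.
Proof.
move=> tau0 mw mpsi mq q0 wB psiB iw wpsi0 wpsi0' psie wq.
have nufin : nu setT \is a fin_num by rewrite fin_num_measure.
set m := fine (nu setT); have mE : m%:E = nu setT by rewrite fineK.
have m0 : 0 <= m by rewrite fine_ge0.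
have maw : measurable_fun setT (EFin \o (fun x => `|w x|)).
  by apply/measurable_EFinP; exact: measurableT_comp.
have iaw : (\int[leb]_x `|w x|%:E < +oo)%E by case/integrableP : iw.
set b := fine (\int[leb]_x `|w x|%:E).
have bE : (b%:E = \int[leb]_x `|w x|%:E)%E.
  by rewrite fineK// ge0_fin_numE// integral_ge0.
have b0 : 0 <= b by rewrite fine_ge0// integral_ge0.
(* The two error terms of [le_levy_op_truncation] each integrate to [m * b], the mass of [nu] times
   the L^1 norm of [w]. *)
have key (d : R) : 0 < d -> (\int[leb]_x (Num.max (w x - d) 0)%:E <=
    (tau * d * (m * b + b * m))%:E + \int[leb]_x q x)%E.
  move=> d0; set e := d * d.
  have e0 : 0 < e by exact: mulr_gt0.
  set p := fun z => Num.max (psi z + d * w z - e) 0.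
  have mp : measurable_fun setT p.
    apply: measurable_maxr => //; apply: measurable_funB => //.
    apply: measurable_funD => //.
    exact: measurable_funM.
  have p0 x : 0 <= p x by rewrite le_max lexx orbT.
  have mEp : measurable_fun setT (EFin \o p) by exact/measurable_EFinP.
  have pB z : `|p z| <= B + d * B.
    have := psiB z; have := wB z; rewrite !ler_norml /p => /andP[w1 w2] /andP[p1 p2].
    have dw := ler_wpM2l (ltW d0) w2; have dw' := ler_wpM2l (ltW d0) w1.
    by case: (leP (psi z + d * w z - e) 0); nra.
  have mpe : measurable_fun setT (EFin \o (fun x => Num.max (psi x - e) 0)).
    apply/measurable_EFinP/measurable_maxr => //.
    exact: measurable_funB.
  (* [p] is at most [(psi - e)^+ + d * |w|], a sum of two integrable functions. Finiteness is what
     permits cancelling the integral of [p] later. *)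
  have pfin : (\int[leb]_x (p x)%:E < +oo)%E.
    apply: (@le_lt_trans _ _ (\int[leb]_x ((Num.max (psi x - e) 0)%:E +
        d%:E * `|w x|%:E)))%E.
      apply: ge0_le_integral => //.
      - by move=> x _; rewrite lee_fin.
      - apply: emeasurable_funD => //; exact: measurable_funeM.
      - move=> x _; rewrite -EFinM -EFinD lee_fin /p.
        have := ler_wpM2l (ltW d0) (ler_norm (w x)).
        have : 0 <= d * `|w x| by rewrite mulr_ge0// ltW.
        case: (leP (psi x + d * w x - e) 0);
          case: (leP (psi x - e) 0); lra.
    rewrite ge0_integralD//; last 3 first.
    - by move=> x _; rewrite lee_fin le_max lexx orbT.
    - by move=> x _; rewrite mule_ge0// lee_fin ltW.
    - exact: measurable_funeM.
    rewrite ge0_integralZl_EFin// ?(ltW d0)//.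
    by rewrite lte_add_pinfty ?psie// lte_mul_pinfty// lee_fin ltW.
  set k := fine (\int[leb]_x (p x)%:E).
  have kE : (k%:E = \int[leb]_x (p x)%:E)%E.
    by rewrite fineK// ge0_fin_numE// integral_ge0// => x _; rewrite lee_fin.
  pose g1 x := (\int[nu]_z (p (x + z))%:E)%E.
  pose g2 x := (\int[nu]_z `|w (x + z)|%:E)%E.
  have mg1 : measurable_fun setT g1.
    by apply: (@measurable_int_rV_add _ _ nu (EFin \o p)) => // x; rewrite /= lee_fin.
  have mg2 : measurable_fun setT g2.
    by apply: (@measurable_int_rV_add _ _ nu (EFin \o (fun x => `|w x|))) => // x;
      rewrite /= lee_fin.
  have g10 x : (0 <= g1 x)%E by apply: integral_ge0 => z _; rewrite lee_fin.
  have g20 x : (0 <= g2 x)%E by apply: integral_ge0.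
  have ig1 : (\int[leb]_x g1 x = (m * k)%:E)%E.
    by rewrite EFinM mE kE -(@ge0_integral_rV_add _ _ nu (EFin \o p)).
  have ig2 : (\int[leb]_x g2 x = (m * b)%:E)%E.
    rewrite EFinM mE bE.
    rewrite -(@ge0_integral_rV_add _ _ nu (EFin \o (fun x => `|w x|)))// => x.
    by rewrite /= lee_fin.
  (* The loss term [tau * m * p x] stays on the left, so that every term is nonnegative and can be
     integrated in the extended reals. *)
  have main : {ae leb, forall x, setT x ->
      (Num.max (w x - d) 0)%:E + (tau * m)%:E * (p x)%:E <=
      tau%:E * g1 x + ((tau * d)%:E * (g2 x + m%:E * `|w x|%:E) + q x)}%E.
    apply: filterS wq => x wqx _.
    have g1E : (g1 x = (\int[nu]_z p (x + z))%:E)%E.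
      rewrite (@EFin_Rintegral_bounded _ (B + d * B))//.
      exact: measurable_comp_rV_add.
    have g2E : (g2 x = (\int[nu]_z `|w (x + z)|)%:E)%E.
      rewrite (@EFin_Rintegral_bounded _ B)//.
        by apply: measurableT_comp => //; exact: measurable_comp_rV_add.
      by move=> z; rewrite normr_id.
    have [|ex] := leP (psi x + d * w x) e.
      move=> xe; have -> : p x = 0 by rewrite /p max_r// subr_le0.
      have wd : w x <= d.
        rewrite leNgt; apply/negP => dw.
        have w0 : 0 < w x by rewrite (lt_trans d0).
        have := wpsi0 _ w0; have : d * d < d * w x by rewrite ltr_pM2l.
        rewrite -/e; lra.
      rewrite max_r ?subr_le0// mule0 adde0 adde_ge0// ?mule_ge0// ?lee_fin//.
      by rewrite adde_ge0// mule_ge0// ?lee_fin ?mulr_ge0 ?(ltW d0)// adde_ge0// lee_fin mulr_ge0.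
    have w0 : 0 < w x.
      rewrite ltNge; apply/negP => w0; have := wpsi0' _ w0.
      have : d * w x <= 0 by rewrite pmulr_rle0.
      lra.
    have := le_levy_op_truncation mw mpsi wB psiB (ltW d0) (ltW e0) (erefl p) ex.
    rewrite -/m => L.
    have {}L := ler_wpM2l tau0 L.
    move: wqx (q0 x); case: (q x) => [r||//].
      rewrite -EFinD lee_fin => wr r0.
      rewrite g1E g2E -!(EFinM, EFinD) lee_fin.
      have : Num.max (w x - d) 0 <= w x.
        by rewrite ge_max (ltW w0) andbT; lra.
      lra.
    by move=> _ _; rewrite g1E g2E -!(EFinM, EFinD); exact: leey.
  have mwd : measurable_fun setT (fun x => (Num.max (w x - d) 0)%:E).
    apply/measurable_EFinP/measurable_maxr => //.
    exact: measurable_funB.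
  have wd0 x : (0 <= (Num.max (w x - d) 0)%:E)%E by rewrite lee_fin le_max lexx orbT.
  have taud : 0 <= tau * d by rewrite mulr_ge0// ltW.
  have mr : measurable_fun setT (fun x => g2 x + m%:E * `|w x|%:E)%E.
    by apply: emeasurable_funD => //; exact: measurable_funeM.
  have r0 x : (0 <= g2 x + m%:E * `|w x|%:E)%E.
    by rewrite adde_ge0// mule_ge0// lee_fin.
  have mr' := measurable_funeM (tau * d)%:E mr.
  have r0' x : (0 <= (tau * d)%:E * (g2 x + m%:E * `|w x|%:E))%E.
    by rewrite mule_ge0// lee_fin.
  have mrq : measurable_fun setT
      (fun x => (tau * d)%:E * (g2 x + m%:E * `|w x|%:E) + q x)%E.
    exact: emeasurable_funD.
  have mp' := measurable_funeM (tau * m)%:E mEp.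
  have mg1' := measurable_funeM tau%:E mg1.
  have tg10 x : (0 <= tau%:E * g1 x)%E by rewrite mule_ge0.
  have tp0 x : (0 <= (tau * m)%:E * (p x)%:E)%E.
    by rewrite mule_ge0// lee_fin// mulr_ge0.
  have : (\int[leb]_x ((Num.max (w x - d) 0)%:E + (tau * m)%:E * (p x)%:E) <=
      \int[leb]_x (tau%:E * g1 x +
        ((tau * d)%:E * (g2 x + m%:E * `|w x|%:E) + q x)))%E.
    apply: ae_ge0_le_integral => //.
    - by move=> x _; exact: adde_ge0.
    - exact: emeasurable_funD.
    - by move=> x _; rewrite adde_ge0// adde_ge0.
    - exact: emeasurable_funD.
  (* The gain term [tau * g1] integrates to the same finite value as the loss term, so the two are
     cancelled below. *)
  have emk : ((tau * m)%:E * k%:E = tau%:E * (m * k)%:E)%E.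
    by rewrite -!EFinM mulrA.
  rewrite ge0_integralD// ge0_integralZl_EFin//; last exact: mulr_ge0.
  rewrite -kE ge0_integralD//; last by move=> x _; rewrite adde_ge0.
  rewrite ge0_integralZl_EFin// ig1 -emk addeC leeD2lE//.
  rewrite ge0_integralD// ge0_integralZl_EFin// ge0_integralD//.
  - rewrite ig2 ge0_integralZl_EFin// -bE -!(EFinM, EFinD).
    by rewrite [(b * m)%R]mulrC.
  - by move=> x _; rewrite mule_ge0// lee_fin.
  - exact: measurable_funeM.
  - by move=> x _; rewrite lee_fin.
have [Qy|Qfin] := eqVneq (\int[leb]_x q x)%E +oo%E.
  by rewrite [leRHS]Qy leey.
move: key; set Q := (X in (_ <= X)%E) => key.
have mwn (c : R) : measurable_fun setT (fun x => (Num.max (w x - c) 0)%:E).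
  apply/measurable_EFinP/measurable_maxr => //.
  exact: measurable_funB.

have {}Qfin : Q \is a fin_num.
  by rewrite ge0_fin_numE ?integral_ge0// lt_neqAle Qfin leey.
(* Now [d = 1 / (n + 1)] tends to 0: the functions [(w - d)^+] increase to [w^+], and monotone
   convergence applies. *)
pose g n x := (Num.max (w x - n.+1%:R^-1) 0)%:E.
have gw : (\int[leb]_x g n x)%E @[n --> \oo] -->
    (\int[leb]_x (Num.max (w x) 0)%:E)%E.
  have gx x : limn (g ^~ x) = (Num.max (w x) 0)%:E.
    apply/cvg_lim => //; apply: cvg_EFin; first exact: nearW.
    have -> : fine \o g ^~ x = (fun n => Num.max (w x - n.+1%:R^-1) 0) by [].
    apply/cvgrPdist_lt => e e0; near=> n.
    have ne : n.+1%:R^-1 < e.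
      by near: n; exact: (near_infty_natSinv_lt (PosNum e0)).
    have n0 : 0 < n.+1%:R^-1 :> R by rewrite invr_gt0.
    move: (_^-1) ne n0 => i ie i0; rewrite ltr_norml; apply/andP; split;
      case: (leP (w x) 0); case: (leP (w x - i) 0); lra.

  under eq_integral do rewrite -gx.
  apply: cvg_monotone_convergence => //.
  - by move=> n; exact: mwn.
  - by move=> n x _; rewrite lee_fin le_max lexx orbT.
  - move=> x _ n k nk; rewrite lee_fin ge_max !le_max lexx !orbT andbT.
    by rewrite lerD2l lerN2 lef_pV2 ?posrE// ler_nat ltnS nk.
apply/lee_addgt0Pr => e e0.
rewrite -(cvg_lim _ gw)//; apply: lime_le; first by apply/cvg_ex; eexists; exact: gw.
(* The [+ 1] keeps the divisor positive when [tau], [m] or [b] vanishes. *)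
have C0 : 0 < tau * (m * b + b * m) + 1.
  by rewrite ltr_wpDl// mulr_ge0// addr_ge0// mulr_ge0.
near=> n.
apply: (le_trans (key n.+1%:R^-1 _)); first by rewrite invr_gt0.
rewrite addeC leeD2l// lee_fin.
have : n.+1%:R^-1 < e / (tau * (m * b + b * m) + 1).
  by near: n; exact: (near_infty_natSinv_lt (PosNum (divr_gt0 e0 C0))).
rewrite ltr_pdivlMr// => ne.
have n0 : 0 < n.+1%:R^-1 :> R by rewrite invr_gt0.
move: (n.+1%:R^-1) ne n0 => i ie i0; lra.
Unshelve. all: by end_near. Qed.

End implicit_step.

(** * Contraction for the explicit part and the source *)

Section explicit_step.
Variables (R : realType) (N : nat).
Variable nu : {finite_measure set 'rV[R]_N -> \bar R}.

Local Notation leb := (lebesgue_rV R N).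

(** The left side of the majorization is [w - tau * m * psi], with [m] the mass of [nu], plus [tau]
    times the gain term of [psi]; [q] replaces both by their positive-part versions [a] and the gain
    of [p]. The gain of [p] integrates like [m * p], and the sign hypotheses, which the CFL
    condition provides, make [a + tau * m * p] equal to [w^+]. *)
Lemma explicit_step (w psi : 'rV[R]_N -> R) (tau B : R) :
  0 <= tau ->
  measurable_fun setT w -> measurable_fun setT psi ->
  (forall z, `|psi z| <= B) ->
  (forall x, 0 <= w x ->
    0 <= psi x /\ 0 <= w x - tau * fine (nu setT) * psi x) ->
  (forall x, w x <= 0 ->
    psi x <= 0 /\ w x - tau * fine (nu setT) * psi x <= 0) ->
  exists q : 'rV[R]_N -> \bar R,
    [/\ measurable_fun setT q, (forall x, 0 <= q x)%E,
        (forall x, (w x + tau * levy_op nu psi x)%:E <= q x)%E &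
        (\int[leb]_x q x = \int[leb]_x (Num.max (w x) 0)%:E)%E].
Proof.
move=> tau0 mw mpsi psiB wp wn.
have nufin : nu setT \is a fin_num by rewrite fin_num_measure.
set m := fine (nu setT) in wp wn *; have mE : m%:E = nu setT by rewrite fineK.
have m0 : 0 <= m by rewrite fine_ge0.
pose a x := Num.max (w x - tau * m * psi x) 0.
pose p x := Num.max (psi x) 0.
have p0 x : 0 <= p x by rewrite le_max lexx orbT.
have a0 x : 0 <= a x by rewrite le_max lexx orbT.
have mp : measurable_fun setT p by exact: measurable_maxr.
have ma : measurable_fun setT a.
  apply: measurable_maxr => //; apply: measurable_funB => //.
  exact: measurable_funM.
have mEp : measurable_fun setT (EFin \o p) by exact/measurable_EFinP.
have mEa : measurable_fun setT (EFin \o a) by exact/measurable_EFinP.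
have pB z : `|p z| <= B.
  by rewrite (le_trans _ (psiB z))// /p; case: (leP (psi z) 0) => _ //; rewrite normr0.
have Ep0 x : (0 <= (EFin \o p) x)%E by rewrite /= lee_fin.
pose I x := (\int[nu]_z (p (x + z))%:E)%E.
have mI : measurable_fun setT I := measurable_int_rV_add nu mEp Ep0.
have I0 x : (0 <= I x)%E by apply: integral_ge0 => z _; rewrite lee_fin.
exists (fun x => (a x)%:E + tau%:E * I x)%E; split.
- by apply: emeasurable_funD => //; exact: measurable_funeM.
- by move=> x; rewrite adde_ge0 ?mule_ge0 ?lee_fin.
- move=> x.
  have mpx := measurable_comp_rV_add x mp.
  rewrite /I -(@EFin_Rintegral_bounded _ _ nu _ B)// -EFinM -EFinD lee_fin.
  rewrite (levy_op_bounded _ _ mpsi psiB) -/m.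
  have le_int : \int[nu]_z psi (x + z) <= \int[nu]_z p (x + z).
    apply: le_Rintegral => //.
    - apply: (@finite_measure_integrable_bounded _ _ _ _ B) => //.
      exact: measurable_comp_rV_add.
    - exact: (@finite_measure_integrable_bounded _ _ _ _ B).
    - by move=> z _; rewrite le_max lexx.
  have := ler_wpM2l tau0 le_int.
  have : w x - tau * m * psi x <= a x by rewrite le_max lexx.
  lra.
- rewrite ge0_integralD//; last 3 first.
  + by move=> x _; rewrite lee_fin.
  + by move=> x _; rewrite mule_ge0.
  + exact: measurable_funeM.
  rewrite ge0_integralZl_EFin//.
  rewrite [in X in (_ + _ * X)%E](@ge0_integral_rV_add _ _ nu (EFin \o p))//.
  rewrite -mE muleA -EFinM -ge0_integralZl_EFin//; last exact: mulr_ge0.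
  rewrite -ge0_integralD//; last 3 first.
  + by move=> x _; rewrite lee_fin.
  + by move=> x _; rewrite mule_ge0// lee_fin// mulr_ge0.
  + exact: measurable_funeM.
  apply: eq_integral => x _; rewrite -EFinM -EFinD; congr EFin; rewrite /a /p.
  have [w0|w0] := leP (w x) 0.
    have [p1 a1] := wn _ w0.
    by rewrite (max_r p1) (max_r a1); ring.
  have [p1 a1] := wp _ (ltW w0).
  by rewrite (max_l p1) (max_l a1); ring.
Qed.

End explicit_step.

(** * Time integrals of the sources: Tonelli and integrable sections *)

Section source.
Variables (R : realType) (N : nat).

Local Notation leb := (lebesgue_rV R N).
Local Notation mu := (@lebesgue_measure R).

Lemma measurable_setT_itv (I : set R) (h : 'rV[R]_N * R -> \bar R) :
  measurable I -> measurable_fun setT h ->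
  measurable_fun setT (h \_ (setT `*` I)).
Proof.
move=> mI mh; apply/(measurable_restrictT _ _).1; first exact: measurableX.
exact: measurable_funTS.
Qed.

Lemma patch_setT_itv (I : set R) (h : 'rV[R]_N * R -> \bar R) x :
  (fun s => (h \_ (setT `*` I)) (x, s)) = (fun s => h (x, s)) \_ I.
Proof.
apply/funext => s; rewrite !patchE.
have -> // : ((x, s) \in setT `*` I) = (s \in I).
by apply/idP/idP; rewrite !inE => // -[].
Qed.

Lemma measurable_int_itv (I : set R) (h : 'rV[R]_N * R -> \bar R) :
  measurable I -> measurable_fun setT h -> (forall p, 0 <= h p)%E ->
  measurable_fun setT (fun x : 'rV[R]_N => \int[mu]_(s in I) h (x, s))%E.
Proof.
move=> mI mh h0; under eq_fun do rewrite integral_mkcond -patch_setT_itv.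
apply: (@measurable_fun_fubini_tonelli_F _ _ _ _ _ mu (h \_ (setT `*` I))).
  exact: measurable_setT_itv.
by move=> p; apply: erestrict_ge0.
Qed.

Lemma fubini_tonelli_itv (I : set R) (h : 'rV[R]_N * R -> \bar R) :
  measurable I -> measurable_fun setT h -> (forall p, 0 <= h p)%E ->
  (\int[leb]_x \int[mu]_(s in I) h (x, s) =
   \int[mu]_(s in I) \int[leb]_x h (x, s))%E.
Proof.
move=> mI mh h0; under eq_integral do rewrite integral_mkcond -patch_setT_itv.
rewrite fubini_tonelli; last 2 first.
- exact: measurable_setT_itv.
- by move=> p; apply: erestrict_ge0.
rewrite [RHS]integral_mkcond; apply: eq_integral => s _; rewrite patchE.
case: ifPn => sI.
  apply: eq_integral => x _; rewrite patchE ifT//.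
  by move: sI; rewrite !inE.
apply: integral0_eq => x _; rewrite patchE ifN//.
by apply: contra sI; rewrite !inE => -[].
Qed.

(** By Tonelli the time integral of [|f|] is integrable in space, hence finite almost everywhere. *)
Lemma ae_integrable_section (I : set R) (f : 'rV[R]_N * R -> R) :
  measurable I -> measurable_fun setT f ->
  (\int[mu]_(s in I) \int[leb]_x `|f (x, s)|%:E < +oo)%E ->
  {ae leb, forall x, mu.-integrable I (fun s => (f (x, s))%:E)}.
Proof.
move=> mI mf foo.
have mh : measurable_fun setT (fun p => `|f p|%:E).
  by apply/measurable_EFinP; exact: measurableT_comp.
have h0 p : (0 <= `|f p|%:E)%E by [].
rewrite -(fubini_tonelli_itv mI mh h0) in foo.
have mF := measurable_int_itv mI mh h0.
have : leb.-integrable setT (fun x => \int[mu]_(s in I) `|f (x, s)|%:E)%E.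
  apply/integrableP; split => //.
  by under eq_integral do rewrite gee0_abs ?integral_ge0//.
move=> /integrable_ae -/(_ measurableT); apply: filterS => x /(_ Logic.I) xfin.
apply/integrableP; split; last by rewrite ltey_eq xfin.
by apply/measurable_EFinP/measurable_funTS; exact: (measurableT_comp mf (pair1_measurable x)).
Qed.

(** Combining the two real-valued integrals into one requires both sections to be integrable, which
    holds for almost every [x]. *)
Lemma ae_source_difference_le (I : set R) (f g : 'rV[R]_N * R -> R) :
  measurable I -> measurable_fun setT f -> measurable_fun setT g ->
  (\int[mu]_(s in I) \int[leb]_x `|f (x, s)|%:E < +oo)%E ->
  (\int[mu]_(s in I) \int[leb]_x `|g (x, s)|%:E < +oo)%E ->
  {ae leb, forall x,
    (\int[mu]_(s in I) f (x, s) - \int[mu]_(s in I) g (x, s))%:E <=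
    \int[mu]_(s in I) (Num.max (f (x, s) - g (x, s)) 0)%:E}%E.
Proof.
move=> mI mf mg /(ae_integrable_section mI mf) intf /(ae_integrable_section mI mg) intg.
move: intf intg; apply: filterS2 => x intf intg.
have intfg : mu.-integrable I (fun s => (f (x, s))%:E - (g (x, s))%:E)%E.
  exact: integrableB.
rewrite -RintegralB// /Rintegral fineK; last exact: integrable_fin_num intfg.
have mx := measurableT_comp mf (pair1_measurable x).
have mx' := measurableT_comp mg (pair1_measurable x).
have mfg : measurable_fun setT (fun s => f (x, s) - g (x, s)).
  exact: measurable_funB.
apply: le_integral => //; last by move=> s _; rewrite lee_fin le_max lexx.
apply: le_integrable intfg => //.
  by apply/measurable_EFinP/measurable_funTS; exact: measurable_maxr.
move=> s _; rewrite -EFinB !abse_EFin lee_fin ger0_norm ?le_max ?lexx ?orbT//.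
by rewrite ge_max ler_norm normr_ge0.
Qed.

End source.

(** * The CFL condition *)

Section lipschitz.
Variable R : realType.

Lemma locally_lipschitz_ball (phi : R -> R) (c : R) : locally_lipschitz phi ->
  exists e k : R, [/\ 0 < e, 0 <= k & forall x y, `|c - x| < e -> `|c - y| < e ->
    `|phi x - phi y| <= k * `|x - y|].
Proof.
move=> /(_ c)[A /nbhs_ballP[e /= e0 eA] [k [_ kA]]].
exists e, (Num.max k 0 + 1); split => //; first by rewrite addr_ge0// le_max lexx orbT.
(* The Lipschitz predicate provides all constants strictly above some [k], hence the [+ 1]; the
   maximum with 0 gives the sign. *)
move=> x y xe ye.
apply: (kA (Num.max k 0 + 1) _ (x, y)); first by rewrite ltr_pwDr// le_max lexx.
by split => /=; apply: eA; rewrite /ball/=.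
Qed.

(** Compactness by a supremum: let [c] be the supremum of the endpoints [s] such that [phi] is
    Lipschitz on [[a, s]]. Local Lipschitz continuity at [c] extends the property to [c + e / 2],
    unless [b] comes first. *)
Lemma locally_lipschitz_segment (phi : R -> R) (a b : R) :
  a <= b -> locally_lipschitz phi ->
  exists2 k, 0 <= k & forall x y, a <= x <= b -> a <= y <= b ->
    `|phi x - phi y| <= k * `|x - y|.
Proof.
move=> ab lphi.
pose P s := exists2 k, 0 <= k & forall x y, a <= x -> x <= y -> y <= s ->
  `|phi y - phi x| <= k * (y - x).
suff [k k0 kP] : P b.
  exists k => // x y /andP[ax xb] /andP[ay yb].
  have [xy|/ltW yx] := leP x y.
    by rewrite distrC [X in k * X]distrC [X in k * X]ger0_norm ?subr_ge0// kP.
  by rewrite [X in k * X]ger0_norm ?subr_ge0// kP.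
pose A := [set s | [/\ a <= s, s <= b & P s]].
have Aa : A a.
  split => //; exists 0 => // x y ax xy ya.
  by rewrite (@le_anti _ _ x y) ?subrr ?normr0 ?mul0r// xy (le_trans ya).
have supA : has_sup A by split; [exists a | exists b => s []].
set c := sup A.
have cb : c <= b by apply: ge_sup; [exists a | move=> s []].
have [e [k [e0 k0 ke]]] := locally_lipschitz_ball c lphi.
have [s As cs] := sup_adherent e0 supA; rewrite -/c in cs.
have sc : s <= c by exact: ub_le_sup supA.2 _ As.
case: As => as_ sb [k' k'0 k'P].
have Ps' : P (Num.min (c + e / 2) b).
  exists (Num.max k k') => [|x y ax xy]; first by rewrite le_max k0.
  rewrite le_min => /andP[yc yb].
  have kk : k * (y - x) <= Num.max k k' * (y - x).
    by rewrite ler_wpM2r ?subr_ge0// le_max lexx.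
  have [ys|sy] := leP y s.
    apply: (le_trans (k'P _ _ ax xy ys)).
    by rewrite ler_wpM2r ?subr_ge0// le_max lexx orbT.
  have cy : `|c - y| < e by rewrite ltr_norml; apply/andP; split; lra.
  have [xs|sx] := leP x s; last first.
    have cx : `|c - x| < e by rewrite ltr_norml; apply/andP; split; lra.
    by have := ke _ _ cy cx; rewrite [X in k * X]ger0_norm ?subr_ge0//; lra.
  (* Here [x <= s < y]: the increment is split at [s], with constant [k'] to its left and [k] to its
     right. *)
  have cs' : `|c - s| < e by rewrite ltr_norml; apply/andP; split; lra.
  have := ke _ _ cy cs'; rewrite [X in k * X]ger0_norm; last by lra.
  have := k'P _ _ ax xs (lexx _).
  have := ler_distD (phi s) (phi y) (phi x).
  have : k * (y - s) <= Num.max k k' * (y - s).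
    by rewrite ler_wpM2r ?le_max ?lexx//; lra.
  have : k' * (s - x) <= Num.max k k' * (s - x).
    by rewrite ler_wpM2r ?le_max ?lexx ?orbT//; lra.
  lra.
(* Otherwise the minimum would be [c + e / 2], an element of [A] above its supremum [c]. *)
suff -> : b = Num.min (c + e / 2) b by [].
have As' : A (Num.min (c + e / 2) b).
  split => //; last by rewrite ge_min lexx orbT.
  by rewrite le_min ab andbT; lra.
have : Num.min (c + e / 2) b <= c by exact: ub_le_sup supA.2 _ As'.
by rewrite minEle; case: ifP => // _; lra.
Qed.

(** The infimum is taken over a nonempty set, by the previous lemma, and is itself a Lipschitz
    constant: each difference quotient is a lower bound of that set. *)
Lemma lipschitz_constantP (phi : R -> R) (M : R) :
  0 <= M -> locally_lipschitz phi ->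
  forall x y, - M <= x <= M -> - M <= y <= M ->
  `|phi x - phi y| <= lipschitz_constant phi `[- M, M] * `|x - y|.
Proof.
move=> M0 lphi x y xM yM.
have [k k0 kP] : exists2 k, 0 <= k & forall x y, - M <= x <= M -> - M <= y <= M ->
    `|phi x - phi y| <= k * `|x - y| by apply: locally_lipschitz_segment => //; lra.
have [->|xy] := eqVneq x y; first by rewrite !subrr !normr0 mulr0.
have xy0 : 0 < `|x - y| by rewrite normr_gt0 subr_eq0.
rewrite -ler_pdivrMr//; apply: lb_le_inf.
  exists k; split => // -[u v] /= [uM vM].
  by apply: kP; [move: uM | move: vM]; rewrite /= in_itv.
move=> l [l0 lP]; rewrite ler_pdivrMr//.
by apply: (lP (x, y)); split; rewrite /= in_itv/=.
Qed.

(** [kappa * (phi s - phi r)] is at most [kappa] times the Lipschitz constant times [s - r], hence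
    at most [s - r]. It is used with [kappa] the time step times the mass of [nu2]. *)
Lemma cfl_monotone (phi : R -> R) (M tau : R) (kappa : R) :
  0 <= M -> locally_lipschitz phi -> {homo phi : x y / x <= y} ->
  0 <= kappa -> kappa * lipschitz_constant phi `[- M, M] <= 1 ->
  forall r s, - M <= r -> r <= s -> s <= M ->
    r - kappa * phi r <= s - kappa * phi s.
Proof.
move=> M0 lphi hphi kappa0 cfl r s Mr rs sM.
have := @lipschitz_constantP phi M M0 lphi s r.
rewrite !ger0_norm ?subr_ge0 ?hphi//.
have -> : - M <= s <= M by rewrite sM andbT; lra.
have -> : - M <= r <= M by rewrite Mr/=; lra.
move=> /(_ isT isT) /(ler_wpM2l kappa0).
have : kappa * lipschitz_constant phi `[- M, M] * (s - r) <= 1 * (s - r).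
  by rewrite ler_wpM2r// subr_ge0.
lra.
Qed.

End lipschitz.

(** * L-infinity bounds *)

Section maximum_principle.
Variables (R : realType) (N : nat).

Local Notation leb := (lebesgue_rV R N).

Lemma levy_opN (nu : {finite_measure set 'rV[R]_N -> \bar R})
    (psi : 'rV[R]_N -> R) (B : R) x :
  measurable_fun setT psi -> (forall z, `|psi z| <= B) ->
  levy_op nu (fun z => - psi z) x = - levy_op nu psi x.
Proof.
move=> mpsi psiB.
rewrite (levy_op_bounded _ _ mpsi psiB).
rewrite (@levy_op_bounded _ _ _ _ B)//; last 2 first.
- exact: measurable_funN.
- by move=> z; rewrite normrN.
have -> : \int[nu]_z (- psi (x + z)) = - \int[nu]_z psi (x + z).
  under eq_Rintegral do rewrite -mulN1r.
  rewrite RintegralZl ?mulN1r//.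
  apply: (@finite_measure_integrable_bounded _ _ _ _ B) => //.
  exact: measurable_comp_rV_add.
by ring.
Qed.

Lemma homo_comp_measurable (phi : R -> R) (U : 'rV[R]_N -> R) :
  {homo phi : x y / x <= y} -> measurable_fun setT U ->
  measurable_fun setT (phi \o U).
Proof.
move=> hphi mU; apply: measurableT_comp => //.
by apply: nondecreasing_measurable => // x y _ _; exact: hphi.
Qed.

Lemma homo_comp_bounded (phi : R -> R) (U : 'rV[R]_N -> R) (B : R) :
  {homo phi : x y / x <= y} -> (forall x, `|U x| <= B) ->
  forall x, `|(phi \o U) x| <= `|phi B| + `|phi (- B)|.
Proof.
move=> hphi UB x /=; have := UB x; rewrite !ler_norml => /andP[/hphi U1 /hphi U2].
have := ler_norm (phi B); have := ler_norm (- phi (- B)); rewrite normrN.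
have := normr_ge0 (phi B); have := normr_ge0 (phi (- B)).
by move=> ? ? ? ?; apply/andP; split; lra.
Qed.

(** Bounding the gain term by its value for the constant [m] leaves
    [r - kappa * phi r + kappa * phi m] at [r = W x], with [kappa] equal to [tau] times the mass. By
    monotonicity it is largest at [r = m], where it equals [m]. *)
Lemma levy_op_le_explicit (nu : {finite_measure set 'rV[R]_N -> \bar R})
    (phi : R -> R) (W : 'rV[R]_N -> R) (tau m : R) x :
  0 <= tau -> {homo phi : x y / x <= y} ->
  measurable_fun setT W -> (forall x, `|W x| <= m) ->
  (forall r s, - m <= r -> r <= s -> s <= m ->
    r - tau * fine (nu setT) * phi r <= s - tau * fine (nu setT) * phi s) ->
  W x + tau * levy_op nu (phi \o W) x <= m.
Proof.
move=> tau0 hphi mW Wm cfl.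
have mp := homo_comp_measurable hphi mW.
have bp := homo_comp_bounded hphi Wm.
rewrite (levy_op_bounded _ _ mp bp).
have : \int[nu]_z (phi \o W) (x + z) <= \int[nu]_z (cst (phi m)) z.
  apply: le_Rintegral => //.
  - apply: (finite_measure_integrable_bounded _ (B := `|phi m| + `|phi (- m)|)) => //.
    exact: measurable_comp_rV_add.
  - exact: finite_measure_integrable_cst.
  - by move=> z _; apply: hphi; have := Wm (x + z); rewrite ler_norml => /andP[].
rewrite Rintegral_cst// => /(ler_wpM2l tau0).
have := Wm x; rewrite ler_norml => /andP[Wx1 Wx2].
have := cfl _ _ Wx1 Wx2 (lexx _).
by rewrite /=; lra.
Qed.

(* If S > C were the essential supremum of U, then
   [U x <= C + tau * nu * (phi S - phi (U x))] and the continuity of phi at S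
   would keep U away from S. *)
Lemma implicit_le (nu : {finite_measure set 'rV[R]_N -> \bar R})
    (phi : R -> R) (U : 'rV[R]_N -> R) (tau B C : R) :
  0 <= tau -> {homo phi : x y / x <= y} -> continuous phi ->
  measurable_fun setT U -> (forall x, `|U x| <= B) ->
  {ae leb, forall x, U x <= C + tau * levy_op nu (phi \o U) x} ->
  {ae leb, forall x, U x <= C}.
Proof.
move=> tau0 hphi cphi mU UB UC.
pose S := fine (ess_sup leb (EFin \o U)).
have leb0 := lebesgue_rV_setT_gt0 R N.
have supB : (ess_sup leb (EFin \o U) <= B%:E)%E.
  by apply/ess_supP/aeW => x /=; rewrite lee_fin (le_trans (ler_norm _)).
have infB : ((- B)%:E <= ess_sup leb (EFin \o U))%E.
  apply: ess_sup_gee => //; apply/aeW => x /=; rewrite lee_fin.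
  by have := UB x; rewrite ler_norml => /andP[].
have SE : S%:E = ess_sup leb (EFin \o U).
  rewrite fineK// fin_numElt (lt_le_trans _ infB) ?ltNyr//.
  by rewrite (le_lt_trans supB) ?ltry.
have US : {ae leb, forall x, U x <= S}.
  have := ess_sup_ge leb (EFin \o U).
  by apply: filterS => x; rewrite -SE lee_fin.
have [SC|CS] := leP S C.
  by apply: filterS US => x /le_trans; exact.
exfalso.
set m := fine (nu setT); have m0 : 0 <= m by rewrite fine_ge0.
have D0 : 0 < (S - C) / 2 / (tau * m + 1).
  by rewrite !divr_gt0 ?subr_gt0// ltr_wpDl// mulr_ge0.
(* With this [e], a point where [U x > S - e] would satisfy [U x < C + (S - C) / 2 <= S - e]. *)
have [e [e0 eSC eS]] : exists e, [/\ 0 < e, e <= (S - C) / 2 &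
    (phi S - phi (S - e)) * (tau * m + 1) < (S - C) / 2].
  have /cvgrPdist_lt/(_ _ D0)/nbhs_ballP[d /= d0 dS] := cphi S.
  exists (Num.min (d / 2) ((S - C) / 2)); split.
  - by rewrite lt_min !divr_gt0// subr_gt0.
  - by rewrite ge_min lexx orbT.
  - rewrite -ltr_pdivlMr; last by rewrite ltr_wpDl// mulr_ge0.
    apply: (le_lt_trans (ler_norm _)); apply: dS; rewrite /ball/=.
    have e0 : 0 < Num.min (d / 2) ((S - C) / 2).
      by rewrite lt_min !divr_gt0// subr_gt0.
    have e1 : Num.min (d / 2) ((S - C) / 2) <= d / 2 by rewrite ge_min lexx.
    by rewrite opprB addrCA subrr addr0 ger0_norm; [lra|exact: ltW].
suff : (ess_sup leb (EFin \o U) <= (S - e)%:E)%E by rewrite -SE lee_fin; lra.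
apply/ess_supP.
(* [U <= S] holds only almost everywhere; truncating at [S] makes it hold at every [x + z] under the
   [nu]-integral, and [levy_op] changes only on a null set. *)
pose U' x := Num.min (U x) S.
have mU' : measurable_fun setT U' by exact: measurable_minr.
have UU' : {ae leb, forall x, (phi \o U) x = (phi \o U') x}.
  by apply: filterS US => x xS; rewrite /= /U' min_l.
have := levy_op_ae nu (homo_comp_measurable hphi mU) (homo_comp_measurable hphi mU') UU'.
move: UC UU' => /= + +.
apply: filterS3 => x xC xU xL; rewrite /= lee_fin leNgt; apply/negP => xe.
have U'B z : `|U' z| <= B + `|S|.
  have := UB z; rewrite !ler_norml /U' => /andP[h1 h2].
  have := normr_ge0 S; have := ler_norm (- S); rewrite normrN.
  by case: (leP (U z) S) => ?; lra.
have mp := homo_comp_measurable hphi mU'.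
have bp := homo_comp_bounded hphi U'B.
have : \int[nu]_z (phi \o U') (x + z) <= \int[nu]_z (cst (phi S)) z.
  apply: le_Rintegral => //.
  - apply: (finite_measure_integrable_bounded _
      (B := `|phi (B + `|S|)| + `|phi (- (B + `|S|))|)) => //.
    exact: measurable_comp_rV_add.
  - exact: finite_measure_integrable_cst.
  - by move=> z _; apply: hphi; rewrite ge_min lexx orbT.
rewrite Rintegral_cst// -/m => /(ler_wpM2l tau0).
move: xC; rewrite xL (levy_op_bounded _ _ mp bp) -/m /= => xC.
have : phi (S - e) <= phi (U' x) by apply: hphi; rewrite le_min (ltW xe); lra.
move=> /(ler_wpM2l (mulr_ge0 tau0 m0)).
have : phi (S - e) <= phi S by apply: hphi; lra.
lra.
Qed.

(** Turns an almost everywhere bound into one valid at every point, as the estimates of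
    [nu]-integrals demand. *)
Definition clamp (m r : R) : R := Num.max (Num.min r m) (- m).

Lemma clamp_id (m r : R) : `|r| <= m -> clamp m r = r.
Proof. by rewrite ler_norml => /andP[r1 r2]; rewrite /clamp min_l// max_l. Qed.

Lemma clamp_norm (m r : R) : 0 <= m -> `|clamp m r| <= m.
Proof.
move=> m0; rewrite ler_norml /clamp le_max lexx orbT/= ge_max ge_min lexx orbT/=.
lra.
Qed.

Lemma le_norm_clamp (m r : R) : 0 <= m -> `|clamp m r| <= `|r|.
Proof.
move=> m0; have := ler_norm r; have := ler_norm (- r); rewrite normrN.
move=> r1 r2; rewrite ler_norml /clamp.
by case: (leP r m) => rm; [case: (leP r (- m)) | case: (leP m (- m))] => rm';
  apply/andP; split; lra.
Qed.

Lemma measurable_clamp (m : R) (U : 'rV[R]_N -> R) :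
  measurable_fun setT U -> measurable_fun setT (clamp m \o U).
Proof. by move=> mU; apply: measurable_maxr => //; exact: measurable_minr. Qed.

(** The explicit terms are at most [m] and the source at most [b], so [implicit_le] applies with
    [C = m + b]; the lower bound follows by symmetry. *)
Lemma scheme_step_bounded
    (nu1 nu2 : {finite_measure set 'rV[R]_N -> \bar R}) (phi1 phi2 : R -> R)
    (U W F : 'rV[R]_N -> R) (tau m b B : R) :
  0 <= tau -> 0 <= m ->
  {homo phi1 : x y / x <= y} -> continuous phi1 ->
  {homo phi2 : x y / x <= y} ->
  (forall r s, - m <= r -> r <= s -> s <= m ->
    r - tau * fine (nu2 setT) * phi2 r <= s - tau * fine (nu2 setT) * phi2 s) ->
  measurable_fun setT U -> measurable_fun setT W ->
  (forall x, `|U x| <= B) -> (forall x, `|W x| <= m) ->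
  {ae leb, forall x, `|tau * F x| <= b} ->
  {ae leb, forall x, U x = W x + tau *
     (levy_op nu1 (phi1 \o U) x + levy_op nu2 (phi2 \o W) x + F x)} ->
  {ae leb, forall x, `|U x| <= m + b}.
Proof.
move=> tau0 m0 hphi1 cphi1 hphi2 cfl mU mW UB Wm Fb E.
have up : {ae leb, forall x, U x <= m + b}.
  apply: (@implicit_le nu1 phi1 U tau B) => //.
  move: Fb E; apply: filterS2 => x; rewrite ler_norml => /andP[_ xF] xE.
  by have := levy_op_le_explicit x tau0 hphi2 mW Wm cfl; lra.
have dn : {ae leb, forall x, - U x <= m + b}.
  (* [- U] solves the scheme for the reflected nonlinearities [- phi (- r)], which inherit
     monotonicity, continuity and the CFL inequality. *)
  pose phi1' r := - phi1 (- r); pose phi2' r := - phi2 (- r).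
  have mp1 := homo_comp_measurable hphi1 mU.
  have bp1 := homo_comp_bounded hphi1 UB.
  have mp2 := homo_comp_measurable hphi2 mW.
  have bp2 := homo_comp_bounded hphi2 Wm.
  apply: (@implicit_le nu1 phi1' (fun x => - U x) tau B) => //.
  - by move=> r s rs; rewrite /phi1' lerN2 hphi1// lerN2.
  - move=> r; apply: cvgN; apply: continuous_comp; first exact: oppr_continuous.
    exact: cphi1.
  - exact: measurable_funN.
  - by move=> x; rewrite normrN.
  move: Fb E; apply: filterS2 => x; rewrite ler_norml => /andP[xF _] xE.
  have -> : phi1' \o (fun x => - U x) = (fun x => - (phi1 \o U) x).
    by apply/funext => z; rewrite /phi1' /= opprK.
  rewrite (levy_opN _ _ mp1 bp1).
  have := @levy_op_le_explicit nu2 phi2' (fun x => - W x) tau m x tau0.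
  have -> : phi2' \o (fun x => - W x) = (fun x => - (phi2 \o W) x).
    by apply/funext => z; rewrite /phi2' /= opprK.
  rewrite (levy_opN _ _ mp2 bp2) => H.
  have {}H : - W x + tau * - levy_op nu2 (phi2 \o W) x <= m.
    apply: H.
    - by move=> r s rs; rewrite /phi2' lerN2 hphi2// lerN2.
    - exact: measurable_funN.
    - by move=> z; rewrite normrN.
    - move=> r s mr rs sm; rewrite /phi2'.
      have := cfl (- s) (- r); lra.
  lra.
by move: up dn; apply: filterS2 => x xu xd; rewrite ler_norml; apply/andP; split; lra.
Qed.

End maximum_principle.

(** * Contraction for one time step *)

Section contraction.
Variables (R : realType) (N : nat).

Local Notation leb := (lebesgue_rV R N).

Lemma levy_opB (nu : {finite_measure set 'rV[R]_N -> \bar R})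
    (p q : 'rV[R]_N -> R) (B C : R) x :
  measurable_fun setT p -> (forall z, `|p z| <= B) ->
  measurable_fun setT q -> (forall z, `|q z| <= C) ->
  levy_op nu (fun z => p z - q z) x = levy_op nu p x - levy_op nu q x.
Proof.
move=> mp pB mq qC.
rewrite (levy_op_bounded _ _ mp pB) (levy_op_bounded _ _ mq qC).
rewrite (@levy_op_bounded _ _ _ _ (B + C)); last 2 first.
- exact: measurable_funB.
- by move=> z; rewrite (le_trans (ler_normB _ _))// lerD.
rewrite RintegralB//.
- by ring.
- apply: (finite_measure_integrable_bounded _ (B := B)) => //.
  exact: measurable_comp_rV_add.
- apply: (finite_measure_integrable_bounded _ (B := C)) => //.
  exact: measurable_comp_rV_add.
Qed.

(* Where U and V are both small, the continuity of phi at 0 gives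
   [phi U - phi V <= e]; elsewhere [|U| + |V|] is bounded from below, so an
   integrable multiple of it dominates the bounded difference. *)
Lemma truncation_lty (phi : R -> R) (U V : 'rV[R]_N -> R) (B e : R) :
  {homo phi : x y / x <= y} -> continuous phi ->
  measurable_fun setT U -> measurable_fun setT V ->
  (forall x, `|U x| <= B) -> (forall x, `|V x| <= B) ->
  leb.-integrable setT (EFin \o U) -> leb.-integrable setT (EFin \o V) ->
  0 < e ->
  (\int[leb]_x (Num.max (phi (U x) - phi (V x) - e) 0)%:E < +oo)%E.
Proof.
move=> hphi cphi mU mV UB VB iU iV e0.
have e20 : 0 < e / 2 by rewrite divr_gt0.
have /cvgrPdist_lt/(_ _ e20)/nbhs_ballP[d /= d0 dphi] := cphi 0.
have {}dphi r : `|r| < d -> `|phi 0 - phi r| < e / 2.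
  by move=> rd; apply: dphi; rewrite /ball/= sub0r normrN.
pose K := `|phi B| + `|phi (- B)|.
have UK := homo_comp_bounded hphi UB; have VK := homo_comp_bounded hphi VB.
have K0 : 0 <= K by rewrite addr_ge0.
(* As soon as [|U x|] or [|V x|] reaches [d], [c * (|U x| + |V x|)] is at least [2 * K], which
   bounds the difference of the nonlinearities. *)
pose c := (K + K) / d.
have c0 : 0 <= c by rewrite divr_ge0 ?addr_ge0// ltW.
have mc : measurable_fun setT (fun x => (c * (`|U x| + `|V x|))%:E).
  apply/measurable_EFinP/measurable_funM => //.
  by apply: measurable_funD; exact: measurableT_comp.
apply: (@le_lt_trans _ _ (\int[leb]_x (c * (`|U x| + `|V x|))%:E))%E.
  apply: ge0_le_integral => //.
  - by move=> x _; rewrite lee_fin le_max lexx orbT.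
  - apply/measurable_EFinP/measurable_maxr => //.
    apply: measurable_funB => //.
    apply: measurable_funB => //.
    + exact: homo_comp_measurable hphi mU.
    + exact: homo_comp_measurable hphi mV.
  - move=> x _; rewrite lee_fin ge_max mulr_ge0 ?addr_ge0// andbT.
    have [Ud|dU] := ltP `|U x| d; last first.
      apply: (@le_trans _ _ (c * d)); last first.
        by rewrite ler_wpM2l// (le_trans dU)// lerDl.
      rewrite /c divfK ?gt_eqF//.
      have := UK x; have := VK x; rewrite -/K /= !ler_norml => /andP[? ?] /andP[? ?].
      lra.
    have [Vd|dV] := ltP `|V x| d; last first.
      apply: (@le_trans _ _ (c * d)); last first.
        by rewrite ler_wpM2l// (le_trans dV)// lerDr.
      rewrite /c divfK ?gt_eqF//.
      have := UK x; have := VK x; rewrite -/K /= !ler_norml => /andP[? ?] /andP[? ?].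
      lra.
    apply: (@le_trans _ _ 0); last by rewrite mulr_ge0// addr_ge0.
    have := dphi _ Ud; have := dphi _ Vd; rewrite !ltr_norml => /andP[? ?] /andP[? ?].
    lra.
have ic : leb.-integrable setT
    (fun x => c%:E * (`|U x|%:E + `|V x|%:E))%E.
  apply: integrableZl => //; apply: integrableD => //.
  - exact: integrable_norm iU.
  - exact: integrable_norm iV.
move/integrableP : ic => [_].
congr (_ < _)%E; apply: eq_integral => x _.
by rewrite gee0_abs -?EFinD -?EFinM// lee_fin mulr_ge0// addr_ge0.
Qed.

Definition scheme_step (nu1 nu2 : {finite_measure set 'rV[R]_N -> \bar R})
    (phi1 phi2 : R -> R) (tau : R) (F W U : 'rV[R]_N -> R) : Prop :=
  {ae leb, forall x, U x = W x + tau *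
     (levy_op nu1 (phi1 \o U) x + levy_op nu2 (phi2 \o W) x + F x)}.

(** [explicit_step] majorizes the explicit terms by some [q2] with the integral of [(W - Z)^+]; then
    [q2 + q] serves as the right-hand side in [implicit_step]. *)
Lemma scheme_step_contraction
    (nu1 nu2 : {finite_measure set 'rV[R]_N -> \bar R}) (phi1 phi2 : R -> R)
    (U V W Z F G : 'rV[R]_N -> R) (q : 'rV[R]_N -> \bar R) (tau m B : R) :
  0 <= tau ->
  {homo phi1 : x y / x <= y} -> continuous phi1 ->
  {homo phi2 : x y / x <= y} ->
  (forall r s, - m <= r -> r <= s -> s <= m ->
    r - tau * fine (nu2 setT) * phi2 r <= s - tau * fine (nu2 setT) * phi2 s) ->
  measurable_fun setT U -> measurable_fun setT V ->
  measurable_fun setT W -> measurable_fun setT Z -> measurable_fun setT q ->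
  (forall x, `|U x| <= B) -> (forall x, `|V x| <= B) ->
  (forall x, `|W x| <= m) -> (forall x, `|Z x| <= m) -> (forall x, 0 <= q x)%E ->
  leb.-integrable setT (EFin \o U) -> leb.-integrable setT (EFin \o V) ->
  scheme_step nu1 nu2 phi1 phi2 tau F W U ->
  scheme_step nu1 nu2 phi1 phi2 tau G Z V ->
  {ae leb, forall x, (tau * F x - tau * G x)%:E <= q x}%E ->
  (\int[leb]_x (Num.max (U x - V x) 0)%:E <=
   \int[leb]_x (Num.max (W x - Z x) 0)%:E + \int[leb]_x q x)%E.
Proof.
move=> tau0 hphi1 cphi1 hphi2 cfl mU mV mW mZ mq UB VB Wm Zm q0 iU iV EU EV FGq.
have mU1 := homo_comp_measurable hphi1 mU; have bU1 := homo_comp_bounded hphi1 UB.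
have mV1 := homo_comp_measurable hphi1 mV; have bV1 := homo_comp_bounded hphi1 VB.
have mW2 := homo_comp_measurable hphi2 mW; have bW2 := homo_comp_bounded hphi2 Wm.
have mZ2 := homo_comp_measurable hphi2 mZ; have bZ2 := homo_comp_bounded hphi2 Zm.
set K1 := `|phi1 B| + `|phi1 (- B)| in bU1 bV1.
set K2 := `|phi2 m| + `|phi2 (- m)| in bW2 bZ2.
have K10 : 0 <= K1 by rewrite addr_ge0.
pose w2 x := W x - Z x; pose psi2 x := (phi2 \o W) x - (phi2 \o Z) x.
have mw2 : measurable_fun setT w2 by exact: measurable_funB.
have mpsi2 : measurable_fun setT psi2 by exact: measurable_funB.
have psi2K z : `|psi2 z| <= K2 + K2.
  by rewrite (le_trans (ler_normB _ _))// lerD.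
have w2_ge0 x : 0 <= w2 x ->
    0 <= psi2 x /\ 0 <= w2 x - tau * fine (nu2 setT) * psi2 x.
  rewrite subr_ge0 => ZW; split; first by rewrite subr_ge0 hphi2.
  move: (Wm x) (Zm x); rewrite !ler_norml => /andP[_ h1] /andP[h2 _].
  by have := cfl _ _ h2 ZW h1; rewrite /psi2 /w2 /=; lra.
have w2_le0 x : w2 x <= 0 ->
    psi2 x <= 0 /\ w2 x - tau * fine (nu2 setT) * psi2 x <= 0.
  rewrite subr_le0 => WZ; split; first by rewrite subr_le0 hphi2.
  move: (Wm x) (Zm x); rewrite !ler_norml => /andP[h1 _] /andP[_ h2].
  by have := cfl _ _ h1 WZ h2; rewrite /psi2 /w2 /=; lra.
have [q2 [mq2 q20 q2E q2I]] :=
  explicit_step tau0 mw2 mpsi2 psi2K w2_ge0 w2_le0.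
rewrite -q2I -ge0_integralD//.
pose w x := U x - V x; pose psi x := (phi1 \o U) x - (phi1 \o V) x.
apply: (@implicit_step _ _ nu1 w psi _ tau (B + B + (K1 + K1))) => //.
- exact: measurable_funB.
- exact: measurable_funB.
- exact: emeasurable_funD.
- by move=> x; exact: adde_ge0.
- move=> z; apply: (@le_trans _ _ (B + B)); last by rewrite lerDl addr_ge0.
  by rewrite (le_trans (ler_normB _ _))// lerD.
- move=> z; apply: (@le_trans _ _ (K1 + K1)).
    by rewrite (le_trans (ler_normB _ _))// lerD.
  by rewrite lerDr (le_trans _ (lerD (UB z) (UB z)))// addr_ge0.
- rewrite (_ : EFin \o w = (fun x => (U x)%:E - (V x)%:E)%E)//.
  exact: integrableB.
- by move=> x; rewrite /w subr_gt0 subr_ge0 => /ltW; exact: hphi1.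
- by move=> x; rewrite /w !subr_le0; exact: hphi1.
- move=> e e0; exact: truncation_lty UB VB iU iV e0.
move: EU EV FGq; apply: filterS3 => x xU xV.
move: (q2E x) (q20 x) (q0 x).
rewrite (levy_opB _ _ mW2 bW2 mZ2 bZ2) /psi (levy_opB _ _ mU1 bU1 mV1 bV1).
case: (q2 x) => [r2| |]//; last by case: (q x) => // *; rewrite leey.
case: (q x) => [r| |]//; last by move=> *; rewrite leey.
rewrite -!EFinD !lee_fin /w /w2 => h1 _ _ h2; lra.
Qed.

(** Clamping changes [U] and [W] on null sets only, and [levy_op_ae] carries this over to the
    nonlocal terms. *)
Lemma clamp_scheme_step
    (nu1 nu2 : {finite_measure set 'rV[R]_N -> \bar R}) (phi1 phi2 : R -> R)
    (U W F : 'rV[R]_N -> R) (tau m B : R) :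
  {homo phi1 : x y / x <= y} -> {homo phi2 : x y / x <= y} ->
  measurable_fun setT U -> measurable_fun setT W ->
  {ae leb, forall x, `|U x| <= B} -> {ae leb, forall x, `|W x| <= m} ->
  scheme_step nu1 nu2 phi1 phi2 tau F W U ->
  scheme_step nu1 nu2 phi1 phi2 tau F (clamp m \o W) (clamp B \o U).
Proof.
move=> hphi1 hphi2 mU mW UB Wm.
have mU' := measurable_clamp B mU; have mW' := measurable_clamp m mW.
have eU : {ae leb, forall x, (phi1 \o U) x = (phi1 \o (clamp B \o U)) x}.
  by apply: filterS UB => x xB /=; rewrite clamp_id.
have eW : {ae leb, forall x, (phi2 \o W) x = (phi2 \o (clamp m \o W)) x}.
  by apply: filterS Wm => x xB /=; rewrite clamp_id.
have := levy_op_ae nu2 (homo_comp_measurable hphi2 mW) (homo_comp_measurable hphi2 mW') eW.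
have := levy_op_ae nu1 (homo_comp_measurable hphi1 mU) (homo_comp_measurable hphi1 mU') eU.
move=> L1 L2 E.
have UW : {ae leb, forall x, `|U x| <= B /\ `|W x| <= m}.
  by move: UB Wm; apply: filterS2 => x; split.
have L12 : {ae leb, forall x,
    levy_op nu1 (phi1 \o U) x = levy_op nu1 (phi1 \o (clamp B \o U)) x /\
    levy_op nu2 (phi2 \o W) x = levy_op nu2 (phi2 \o (clamp m \o W)) x}.
  by move: L1 L2; apply: filterS2 => x; split.
move: UW L12 E; apply: filterS3 => x [xB xm] [xL1 xL2] xE.
transitivity (U x); first exact: clamp_id.
rewrite xE xL1 xL2.
have -> : (clamp m \o W) x = W x by exact: clamp_id.
by [].
Qed.

End contraction.

(** * Sections of the source *)

Section source_sup.
Variables (R : realType) (N : nat).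

Local Notation leb := (lebesgue_rV R N).
Local Notation mu := (@lebesgue_measure R).

Lemma LnormyE (h : 'rV[R]_N -> \bar R) :
  'N[leb]_+oo[h]%E = ess_sup leb (abse \o h).
Proof. by rewrite unlock lebesgue_rV_setT_gt0. Qed.

Lemma ae_le_Lnormy (h : 'rV[R]_N -> R) :
  {ae leb, forall x, (`|h x|%:E <= 'N[leb]_+oo[EFin \o h])%E}.
Proof. by rewrite LnormyE; exact: ess_sup_ge. Qed.

(** The norm of the slice at [s] exceeds [r] exactly when the slice of [{|f| > r}] has positive
    measure, and the measure of slices is measurable in [s]. *)
Lemma measurable_Lnormy_section (f : 'rV[R]_N * R -> R) :
  measurable_fun setT f ->
  measurable_fun setT
    (fun s : R => 'N[leb]_+oo[EFin \o (fun x => f (x, s))]%E).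
Proof.
move=> mf mD; apply: (measurability _ (ErealGenOInfty.measurableE R)) => //.
move=> _ [_ [r ->] <-]; rewrite setTI.
pose A := [set p | r < `|f p|].
have mA : measurable A.
  rewrite (_ : A = (fun p => `|f p|) @^-1` `]r, +oo[%classic); last first.
    by apply/seteqP; split => p /=; rewrite in_itv/= andbT.
  rewrite -[X in measurable X]setTI.
  by apply: measurableT_comp mf _ _ _ => //; exact: measurable_itv.
have mnu : measurable_fun setT (leb \o ysection A).
  exact: measurable_fun_ysection.
have -> : (fun s : R => 'N[leb]_+oo[EFin \o (fun x => f (x, s))]%E) @^-1`
    `]r%:E, +oo[%classic = ~` ((leb \o ysection A) @^-1` [set 0%E]).
  apply/seteqP; split => s /=; rewrite in_itv/= andbT LnormyE.
    rewrite ltNge => /negP + H; apply; apply/ess_supP.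
    exists (ysection A s); split => //; first exact: measurable_ysection.
    move=> x /= /negP; rewrite -ltNge lte_fin /ysection/= => rx.
    by rewrite /mkset inE.
  move=> H; rewrite ltNge; apply/negP => /ess_supP sr; apply: H.
  apply/negligibleP; first exact: measurable_ysection.
  apply: negligibleS sr => x; rewrite /ysection/= inE /A /= => rx.
  by apply/negP; rewrite -ltNge lte_fin.
by apply: measurableC; rewrite -[X in measurable X]setTI; apply: mnu => //;
  exact: emeasurable_set1.
Qed.

Lemma measurable_Lnorm1_section (f : 'rV[R]_N * R -> R) :
  measurable_fun setT f ->
  measurable_fun setT
    (fun s : R => 'N[leb]_1[EFin \o (fun x => f (x, s))]%E).
Proof.
move=> mf; under eq_fun do rewrite Lnorm1.
apply: (@measurable_fun_fubini_tonelli_G _ _ _ _ _ leb (fun p => `|f p|%:E)) => //.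
by apply/measurable_EFinP; exact: measurableT_comp.
Qed.

(** Tonelli for the indicator of [A]: a set with null slices in one direction has almost all slices
    null in the other. *)
Lemma ae_section_swap (A : set ('rV[R]_N * R)) : measurable A ->
  (forall s, {ae leb, forall x, ~ A (x, s)}) ->
  {ae leb, forall x, {ae mu, forall s, ~ A (x, s)}}.
Proof.
move=> mA As.
pose g : 'rV[R]_N * R -> \bar R := EFin \o \1_A.
have mg : measurable_fun setT g by exact/measurable_EFinP/measurable_indic.
have g0 p : (0 <= g p)%E by rewrite /g /= lee_fin.
have mF := @measurable_fun_fubini_tonelli_F _ _ _ _ _ mu _ mg g0.
have I : (\int[leb]_x \int[mu]_s g (x, s) = 0)%E.
  rewrite fubini_tonelli//; apply: integral0_eq => s _.
  rewrite -[RHS](integral0 leb setT); apply: ge0_ae_eq_integral => //.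
    exact: (measurableT_comp mg (pair2_measurable s)).
  by apply: filterS (As s) => x xA _; rewrite /g /= indicE memNset.
have : {ae leb, forall x, (\int[mu]_s g (x, s) = 0)%E}.
  have [+ _] := ae_eq_integral_abs leb measurableT mF.
  under eq_integral do rewrite gee0_abs ?integral_ge0//.
  by move=> /(_ I); apply: filterS => x /(_ Logic.I).
apply: filterS => x x0.
have mx := measurableT_comp mg (pair1_measurable x).
have [+ _] := ae_eq_integral_abs mu measurableT mx.
have -> : (\int[mu]_s `|(g \o pair x) s| = 0)%E.
  by rewrite -[RHS]x0; apply: eq_integral => s _; rewrite gee0_abs//; exact: g0.
move=> /(_ erefl); apply: filterS => s /(_ Logic.I) + As'.
by rewrite /g /= indicE mem_set// => -[/eqP]; rewrite oner_eq0.
Qed.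

(** The points where [|f|] exceeds the L^infinity norm of its time slice form a measurable set with
    null slices. By [ae_section_swap], for almost every [x] the bound holds at almost every time and
    can be integrated. *)
Lemma ae_norm_source_le (I : set R) (f : 'rV[R]_N * R -> R) :
  measurable I -> measurable_fun setT f ->
  (\int[mu]_(s in I) \int[leb]_x `|f (x, s)|%:E < +oo)%E ->
  {ae leb, forall x, (`|\int[mu]_(s in I) f (x, s)|%:E <=
    \int[mu]_(s in I) 'N[leb]_+oo[EFin \o (fun x => f (x, s))])%E}.
Proof.
move=> mI mf foo; have mN := measurable_Lnormy_section mf.
set n := (fun s : R => _) in mN.
pose A := [set p : 'rV[R]_N * R | (n p.2 < `|f p|%:E)%E].
have mA : measurable A.
  rewrite -[X in measurable X]setTI.
  apply: emeasurable_fun_lt => //.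
  - exact: (measurableT_comp mN measurable_snd).
  - by apply/measurable_EFinP; exact: measurableT_comp.
have As s : {ae leb, forall x, ~ A (x, s)}.
  by apply: filterS (ae_le_Lnormy (fun x => f (x, s))) => x xn; apply/negP; rewrite -leNgt.
move: (ae_section_swap mA As) (ae_integrable_section mI mf foo).
apply: filterS2 => x xA xint.
have mx := measurableT_comp mf (pair1_measurable x).
rewrite EFin_normr_Rintegral//; apply: (le_trans (le_abse_integral _ _ _)) => //.
  by apply/measurable_EFinP/measurable_funTS.
apply: ae_ge0_le_integral => //.
- by apply/measurable_EFinP/measurable_funTS; exact: measurableT_comp.
- by move=> s _; exact: Lnorm_ge0.
- exact: (measurable_funTS mN).
- apply: (@filterS _ _ (ae_filter_ringOfSetsType mu) _ _ _ xA) => s /negP.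
  by rewrite -leNgt.
Qed.

End source_sup.

(** * The scheme *)

Section scheme.
Variables (R : realType) (N : nat) (T : R) (J : nat) (t : nat -> R).
Hypothesis grid : time_grid T J t.

Local Notation leb := (lebesgue_rV R N).
Local Notation mu := (@lebesgue_measure R).

Lemma time_grid_le i j : (i <= j <= J)%N -> t i <= t j.
Proof.
case: grid => _ _ tS; elim: j => [|j IH]; first by case/andP; rewrite leqn0 => /eqP ->.
move=> /andP[]; rewrite leq_eqVlt => /predU1P[-> //|].
rewrite ltnS => ij jJ; apply: (@le_trans _ _ (t j)); last exact/ltW/tS.
by apply: IH; rewrite ij ltnW.
Qed.

Lemma time_grid_ge0 j : (j <= J)%N -> 0 <= t j.
Proof. by case: grid => t0 _ _ jJ; rewrite -t0 time_grid_le. Qed.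

Lemma time_grid_le_T j : (j <= J)%N -> t j <= T.
Proof. by case: grid => _ tJ _ jJ; rewrite -tJ time_grid_le// jJ/=. Qed.

Lemma time_step_gt0 j : (j < J)%N -> 0 < time_step t j.+1.
Proof. by case: grid => _ _ tS jJ; rewrite subr_gt0 tS. Qed.

Lemma time_step_le_max j : (j < J)%N -> time_step t j.+1 <= max_time_step J t.
Proof. by move=> jJ; apply: le_bigmax_seq => //; rewrite mem_index_iota. Qed.

Lemma sub_time_interval j : (j < J)%N -> `]t j, t j.+1[ `<=` `]0, T[.
Proof.
move=> jJ s /=; rewrite !in_itv/= => /andP[s1 s2].
by rewrite (le_lt_trans (time_grid_ge0 (ltnW jJ)) s1) (lt_le_trans s2)// time_grid_le_T.
Qed.

Lemma ge0_integral_time_split (h : R -> \bar R) j :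
  measurable_fun setT h -> (forall s, 0 <= h s)%E -> (j < J)%N ->
  (\int[mu]_(s in `]0%R, t j.+1[) h s =
   \int[mu]_(s in `]0%R, t j[) h s + \int[mu]_(s in `]t j, t j.+1[) h s)%E.
Proof.
move=> mh h0 jJ.
(* The point [t j] is first put into the left interval, then dropped as a null set. *)
rewrite (@itv_bndbnd_setU _ _ _ (BRight (t j))); last 2 first.
- by rewrite bnd_simp time_grid_ge0// ltnW.
- by rewrite bnd_simp; case: grid => _ _; exact.
rewrite ge0_integral_setU//=; last 2 first.
- exact: measurable_funTS.
- apply/disj_setPS => s /= []; rewrite !in_itv/= => /andP[_ s1] /andP[s2 _].
  by have := le_lt_trans s1 s2; rewrite ltxx.
by rewrite -integral_itv_bndo_bndc//; exact: measurable_funTS.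
Qed.

Variables (nu1 nu2 : {finite_measure set 'rV[R]_N -> \bar R}).
Variables (phi1 phi2 : R -> R).
Hypotheses (hphi1 : {homo phi1 : x y / x <= y}) (cphi1 : continuous phi1).
Hypothesis hphi2 : {homo phi2 : x y / x <= y}.
Variable M : R.
Hypothesis cfl : forall j, (j < J)%N -> forall r s, - M <= r -> r <= s -> s <= M ->
  r - time_step t j.+1 * fine (nu2 setT) * phi2 r <=
  s - time_step t j.+1 * fine (nu2 setT) * phi2 s.

Lemma L1_Linfty_bounded (u : 'rV[R]_N -> R) : L1_Linfty u ->
  exists2 B, 0 <= B & {ae leb, forall x, `|u x| <= B}.
Proof.
move=> [_ /andP[_]]; rewrite inE /= /finite_norm => uoo.
exists (fine 'N[leb]_+oo[EFin \o u]%E); first exact/fine_ge0/Lnorm_ge0.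
apply: filterS (ae_le_Lnormy u) => x.
by rewrite -lee_fin fineK// ge0_fin_numE// Lnorm_ge0.
Qed.

Lemma L1_Linfty_measurable (u : 'rV[R]_N -> R) : L1_Linfty u -> measurable_fun setT u.
Proof. by move=> [/Lfun1_integrable/integrableP[/measurable_EFinP]]. Qed.

(** The induction carries the sharper bound with the source integrated only up to [t j]. It stays
    below [M], so the CFL inequality is available for the next step. *)
Lemma ae_solution_bounded (u0 : 'rV[R]_N -> R) (f : 'rV[R]_N * R -> R)
    (U : nat -> 'rV[R]_N -> R) :
  measurable_fun setT f ->
  (\int[mu]_(s in `]0%R, T[) \int[leb]_x `|f (x, s)|%:E < +oo)%E ->
  (data_bound T u0 f <= M%:E)%E ->
  ae_solution J t nu1 nu2 phi1 phi2 u0 f U ->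
  forall j, (j <= J)%N -> {ae leb, forall x, `|U j x| <= M}.
Proof.
move=> mf foo dM [LU U0 US].
pose n s := 'N[leb]_+oo[EFin \o (fun x => f (x, s))]%E.
have mn : measurable_fun setT n := measurable_Lnormy_section mf.
have n0 s : (0 <= n s)%E by exact: Lnorm_ge0.
have leM j : (j <= J)%N -> ('N[leb]_+oo[EFin \o u0] +
    \int[mu]_(s in `]0%R, t j[) n s <= M%:E)%E.
  move=> jJ; apply: le_trans dM; apply: leeD2l.
  apply: ge0_subset_integral => //; first exact: measurable_funTS.
  by apply: subset_itvl; rewrite bnd_simp time_grid_le_T.
have finM (y : \bar R) : (0 <= y)%E -> (y <= M%:E)%E -> y \is a fin_num.
  by move=> y0 yM; rewrite ge0_fin_numE// (le_lt_trans yM)// ltry.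
suff H j : (j <= J)%N -> exists m, [/\ 0 <= m,
    (m%:E = 'N[leb]_+oo[EFin \o u0] + \int[mu]_(s in `]0%R, t j[) n s)%E &
    {ae leb, forall x, `|U j x| <= m}].
  move=> j jJ; have [m [_ mE]] := H j jJ; apply: filterS => x /le_trans; apply.
  by rewrite -lee_fin mE leM.
elim: j => [|j IH] jJ.
  have t0 : t 0%N = 0 by case: grid.
  have I0 : (\int[mu]_(s in `]0%R, t 0%N[) n s = 0)%E.
    by rewrite t0 set_itvoo0 integral_set0.
  have := leM _ (leq0n J); rewrite I0 adde0 => u0M.
  exists (fine 'N[leb]_+oo[EFin \o u0]%E).
  split; [exact/fine_ge0/Lnorm_ge0|by rewrite fineK// finM// Lnorm_ge0|].
  move: U0 (ae_le_Lnormy u0); apply: filterS2 => x ->.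
  by rewrite -lee_fin fineK// finM// Lnorm_ge0.
have [m [m0 mE Um]] := IH (ltnW jJ).
have mM : m <= M by rewrite -lee_fin mE leM// ltnW.
have jM := leM _ jJ.
rewrite ge0_integral_time_split// addeA -mE in jM *.
set I := (\int[mu]_(s in `]t j, t j.+1[) n s)%E in jM *.
have I0 : (0 <= I)%E by apply: integral_ge0.
have Ifin : I \is a fin_num.
  by apply: finM => //; apply: le_trans jM; rewrite leeDr// lee_fin.
exists (m + fine I); split.
- by rewrite addr_ge0// fine_ge0.
- by rewrite EFinD fineK.
have tau0 := time_step_gt0 jJ; set tau := time_step t j.+1 in tau0.
have [B B0 UB] := L1_Linfty_bounded (LU _ jJ).
have mU := L1_Linfty_measurable (LU _ jJ).
have mW := L1_Linfty_measurable (LU _ (ltnW jJ)).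
have step : scheme_step nu1 nu2 phi1 phi2 tau (source_average t f j.+1) (U j) (U j.+1).
  by have := US j.+1; rewrite jJ => /(_ isT).
(* [B] is any bound of the new iterate; the bound obtained below does not depend on it. *)
have step' := clamp_scheme_step hphi1 hphi2 mU mW UB Um step.
have foo' : (\int[mu]_(s in `]t j, t j.+1[) \int[leb]_x `|f (x, s)|%:E < +oo)%E.
  apply: le_lt_trans foo; apply: ge0_subset_integral => //.
  - apply: measurable_funTS.
    apply: (@measurable_fun_fubini_tonelli_G _ _ _ _ _ leb (fun p => `|f p|%:E)) => //.
    by apply/measurable_EFinP; exact: measurableT_comp.
  - by move=> s _; apply: integral_ge0.
  - exact: sub_time_interval.
have Fb : {ae leb, forall x, `|tau * source_average t f j.+1 x| <= fine I}.
  apply: filterS (ae_norm_source_le _ mf foo') => // x.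
  rewrite /source_average /= mulrA divff ?gt_eqF// mul1r => xI.
  by rewrite -lee_fin fineK.
have cfl' r s : - m <= r -> r <= s -> s <= m ->
    r - tau * fine (nu2 setT) * phi2 r <= s - tau * fine (nu2 setT) * phi2 s.
  by move=> mr rs sm; apply: cfl => //; lra.
have := scheme_step_bounded (ltW tau0) m0 hphi1 cphi1 hphi2 cfl'
  (measurable_clamp B mU) (measurable_clamp m mW)
  (fun x => clamp_norm (U j.+1 x) B0) (fun x => clamp_norm (U j x) m0) Fb step'.
by move: UB; apply: filterS2 => x xB /=; rewrite clamp_id.
Qed.

Lemma integrable_clamp (m : R) (u : 'rV[R]_N -> R) : 0 <= m ->
  leb.-integrable setT (EFin \o u) -> leb.-integrable setT (EFin \o (clamp m \o u)).
Proof.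
move=> m0 iu; have /integrableP[/measurable_EFinP mu' _] := iu.
apply: le_integrable iu => //.
  by apply/measurable_EFinP; exact: measurable_clamp.
by move=> x _ /=; rewrite lee_fin le_norm_clamp.
Qed.

Lemma ae_solution_contraction (u0 v0 : 'rV[R]_N -> R) (f g : 'rV[R]_N * R -> R)
    (U V : nat -> 'rV[R]_N -> R) :
  measurable_fun setT u0 -> measurable_fun setT v0 ->
  measurable_fun setT f -> measurable_fun setT g ->
  (\int[mu]_(s in `]0%R, T[) \int[leb]_x `|f (x, s)|%:E < +oo)%E ->
  (\int[mu]_(s in `]0%R, T[) \int[leb]_x `|g (x, s)|%:E < +oo)%E ->
  (data_bound T u0 f <= M%:E)%E -> (data_bound T v0 g <= M%:E)%E ->
  ae_solution J t nu1 nu2 phi1 phi2 u0 f U ->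
  ae_solution J t nu1 nu2 phi1 phi2 v0 g V ->
  forall j, (j <= J)%N ->
  (\int[leb]_x (Num.max (U j x - V j x) 0)%:E <=
   \int[leb]_x (Num.max (u0 x - v0 x) 0)%:E +
   \int[mu]_(s in `]0%R, t j[)
     \int[leb]_x (Num.max (f (x, s) - g (x, s)) 0)%:E)%E.
Proof.
move=> mu0 mv0 mf mg foo goo fM gM solU solV.
have UM := ae_solution_bounded mf foo fM solU.
have VM := ae_solution_bounded mg goo gM solV.
case: solU solV => [LU U0 US] [LV V0 VS].
have M0 : 0 <= M.
  rewrite -lee_fin; apply: le_trans fM; apply: adde_ge0; first exact: Lnorm_ge0.
  by apply: integral_ge0 => s _; exact: Lnorm_ge0.
have mpos (u v : 'rV[R]_N -> R) : measurable_fun setT u -> measurable_fun setT v ->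
    measurable_fun setT (fun x => (Num.max (u x - v x) 0)%:E).
  move=> mu' mv'; apply/measurable_EFinP/measurable_maxr => //.
  exact: measurable_funB.
have pos0 (r : R) : (0 <= (Num.max r 0)%:E)%E by rewrite lee_fin le_max lexx orbT.
pose h p := (Num.max (f p - g p) 0)%:E.
have mh : measurable_fun setT h.
  apply/measurable_EFinP/measurable_maxr => //.
  exact: measurable_funB.
have h0 p : (0 <= h p)%E by exact: pos0.
have mH : measurable_fun setT (fun s => \int[leb]_x h (x, s))%E.
  exact: (@measurable_fun_fubini_tonelli_G _ _ _ _ _ leb h).
have H0 s : (0 <= \int[leb]_x h (x, s))%E by apply: integral_ge0.
elim=> [|j IH] jJ.
  have t0 : t 0%N = 0 by case: grid.
  rewrite t0 set_itvoo0 integral_set0 adde0.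
  have mU := L1_Linfty_measurable (LU _ jJ); have mV := L1_Linfty_measurable (LV _ jJ).
  rewrite le_eqVlt; apply/orP; left; apply/eqP.
  apply: ge0_ae_eq_integral => //; [exact: mpos|exact: mpos|].
  by move: U0 V0; apply: filterS2 => x -> -> _.
have mU := L1_Linfty_measurable (LU _ jJ); have mV := L1_Linfty_measurable (LV _ jJ).
have mW := L1_Linfty_measurable (LU _ (ltnW jJ)).
have mZ := L1_Linfty_measurable (LV _ (ltnW jJ)).
have iU : leb.-integrable setT (EFin \o U j.+1).
  by have [/Lfun1_integrable] := LU _ jJ.
have iV : leb.-integrable setT (EFin \o V j.+1).
  by have [/Lfun1_integrable] := LV _ jJ.
have tau0 := time_step_gt0 jJ; set tau := time_step t j.+1 in tau0.
have stepU : scheme_step nu1 nu2 phi1 phi2 tau (source_average t f j.+1) (U j) (U j.+1).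
  by have := US j.+1; rewrite jJ => /(_ isT).
have stepV : scheme_step nu1 nu2 phi1 phi2 tau (source_average t g j.+1) (V j) (V j.+1).
  by have := VS j.+1; rewrite jJ => /(_ isT).
(* All iterates are replaced by representatives with values in [[-M, M]], the range of the CFL
   inequality; [clampE] below returns to the original ones. *)
have {}stepU := clamp_scheme_step hphi1 hphi2 mU mW (UM _ jJ) (UM _ (ltnW jJ)) stepU.
have {}stepV := clamp_scheme_step hphi1 hphi2 mV mZ (VM _ jJ) (VM _ (ltnW jJ)) stepV.
have sub (k : 'rV[R]_N * R -> R) : measurable_fun setT k ->
    (\int[mu]_(s in `]0%R, T[) \int[leb]_x `|k (x, s)|%:E < +oo)%E ->
    (\int[mu]_(s in `]t j, t j.+1[) \int[leb]_x `|k (x, s)|%:E < +oo)%E.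
  move=> mk; apply: le_lt_trans; apply: ge0_subset_integral => //.
  - apply: measurable_funTS.
    apply: (@measurable_fun_fubini_tonelli_G _ _ _ _ _ leb (fun p => `|k p|%:E)) => //.
    by apply/measurable_EFinP; exact: measurableT_comp.
  - by move=> s _; apply: integral_ge0.
  - exact: sub_time_interval.
(* The time step cancels the averaging factor of the source, so the integral of [(f - g)^+] over
   this step is the majorant required. *)
pose q x := (\int[mu]_(s in `]t j, t j.+1[) h (x, s))%E.
have mI : measurable (`]t j, t j.+1[ : set R) by exact: measurable_itv.
have mq : measurable_fun setT q by exact: measurable_int_itv.
have q0 x : (0 <= q x)%E by apply: integral_ge0.
have qE : (\int[leb]_x q x = \int[mu]_(s in `]t j, t j.+1[) \int[leb]_x h (x, s))%E.
  exact: fubini_tonelli_itv.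
have FGq : {ae leb, forall x, ((tau * source_average t f j.+1 x -
    tau * source_average t g j.+1 x)%:E <= q x)%E}.
  apply: filterS (ae_source_difference_le mI mf mg (sub _ mf foo) (sub _ mg goo)) => x.
  by rewrite /source_average /= !mulrA divff ?gt_eqF// !mul1r.
have := scheme_step_contraction (ltW tau0) hphi1 cphi1 hphi2 (cfl jJ)
  (measurable_clamp M mU) (measurable_clamp M mV)
  (measurable_clamp M mW) (measurable_clamp M mZ) mq
  (fun x => clamp_norm (U j.+1 x) M0) (fun x => clamp_norm (V j.+1 x) M0)
  (fun x => clamp_norm (U j x) M0) (fun x => clamp_norm (V j x) M0) q0
  (integrable_clamp M0 iU) (integrable_clamp M0 iV) stepU stepV FGq.
have clampE k : (k <= J)%N ->
    (\int[leb]_x (Num.max ((clamp M \o U k) x - (clamp M \o V k) x) 0)%:E =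
     \int[leb]_x (Num.max (U k x - V k x) 0)%:E)%E.
  move=> kJ; have mUk := L1_Linfty_measurable (LU _ kJ).
  have mVk := L1_Linfty_measurable (LV _ kJ).
  apply: ge0_ae_eq_integral => //.
  - by apply: mpos; exact: measurable_clamp.
  - exact: mpos.
  - by move: (UM _ kJ) (VM _ kJ); apply: filterS2 => x xU xV _; rewrite /= !clamp_id.
rewrite (clampE _ jJ) (clampE _ (ltnW jJ)) qE => /le_trans; apply.
rewrite ge0_integral_time_split// addeA leeD2r//.
exact: IH (ltnW jJ).
Qed.

End scheme.

(** * Extension of the sources by zero outside the time interval *)

Section source_extension.
Variables (R : realType) (N : nat) (T : R) (f : 'rV[R]_N * R -> R).

Local Notation leb := (lebesgue_rV R N).
Local Notation mu := (@lebesgue_measure R).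
Local Notation f' := (f \_ (setT `*` `]0, T[)).

Lemma source_extensionE (s : R) : `]0, T[%classic s ->
  (fun x => f' (x, s)) = (fun x => f (x, s)).
Proof. by move=> s0T; apply/funext => x; rewrite patchE mem_set. Qed.

Lemma data_bound_extension u : data_bound T u f' = data_bound T u f.
Proof.
congr (_ + _)%E; apply: eq_integral => s; rewrite inE => s0T.
by rewrite source_extensionE.
Qed.

Hypothesis srcf : source_condition T f.

(** The source is given as measurable on the time strip only, while the Tonelli arguments ask for
    measurability on the whole product. *)
Lemma measurable_source_extension : measurable_fun setT f'.
Proof.
apply/(measurable_restrictT _ _).1; last exact: srcf.1.
by apply: measurableX => //; exact: measurable_itv.
Qed.

(** Splitting the integral of the sum of the two norms relies on both being measurable in time. *)
Lemma source_extension_lty :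
  (\int[mu]_(s in `]0%R, T[) 'N[leb]_1[EFin \o (fun x => f' (x, s))] < +oo)%E /\
  (\int[mu]_(s in `]0%R, T[) 'N[leb]_+oo[EFin \o (fun x => f' (x, s))] < +oo)%E.
Proof.
have [_ foo] := srcf.
have mf := measurable_source_extension.
have m1 := measurable_Lnorm1_section mf; have my := measurable_Lnormy_section mf.
have : (\int[mu]_(s in `]0%R, T[) ('N[leb]_1[EFin \o (fun x => f' (x, s))] +
    'N[leb]_+oo[EFin \o (fun x => f' (x, s))]) < +oo)%E.
  congr (_ < _)%E : foo; apply: eq_integral => s; rewrite inE => s0T.
  by rewrite source_extensionE.
rewrite ge0_integralD//; last 4 first.
- by move=> s _; exact: Lnorm_ge0.
- exact: (measurable_funTS m1).
- by move=> s _; exact: Lnorm_ge0.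
- exact: (measurable_funTS my).
move=> foo'; split; apply: le_lt_trans foo'.
- by rewrite leeDl// integral_ge0// => s _; exact: Lnorm_ge0.
- by rewrite leeDr// integral_ge0// => s _; exact: Lnorm_ge0.
Qed.

Lemma source_extension_L1_lty :
  (\int[mu]_(s in `]0%R, T[) \int[leb]_x `|f' (x, s)|%:E < +oo)%E.
Proof.
have [+ _] := source_extension_lty.
by under eq_integral do rewrite Lnorm1.
Qed.

(** Guarantees that the [fine] defining [M] is applied to a finite value and not to [+oo], which it
    would send to 0. *)
Lemma data_bound_lty u : L1_Linfty u -> (data_bound T u f < +oo)%E.
Proof.
move=> [_ /andP[_]]; rewrite inE /= /finite_norm => uoo.
rewrite -data_bound_extension /data_bound lte_add_pinfty//.
by have [] := source_extension_lty.
Qed.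

Lemma ae_solution_extension (J : nat) (t : nat -> R) nu1 nu2 phi1 phi2 u0 U :
  time_grid T J t ->
  ae_solution J t nu1 nu2 phi1 phi2 u0 f U ->
  ae_solution J t nu1 nu2 phi1 phi2 u0 f' U.
Proof.
move=> grid [LU U0 US]; split => // -[//|j] jJ.
have := US j.+1 jJ; apply: filterS => x ->.
congr (_ + _ * (_ + _)); congr (_ * _); apply: eq_Rintegral => s; rewrite inE => sj.
by rewrite patchE mem_set//; split => //; exact: (sub_time_interval grid jJ sj).
Qed.

End source_extension.

Lemma lipschitz_constant_ge0 (R : realType) (phi : R -> R) (A : set R) :
  0 <= lipschitz_constant phi A.
Proof.
rewrite /lipschitz_constant; set S := [set k | _].
have [->|/set0P S0] := eqVneq S set0; first by rewrite inf0.
by apply: lb_le_inf => // k [].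
Qed.

Theorem theorem2p8 (R : realType) (N : nat) (T : R) (J : nat) (t : nat -> R)
    (nu1 nu2 : {finite_measure set 'rV[R]_N -> \bar R}) (phi1 phi2 : R -> R)
    (u0 v0 : 'rV[R]_N -> R) (f g : 'rV[R]_N * R -> R)
    (U V : nat -> 'rV[R]_N -> R) :
  0 < T ->
  time_grid T J t ->
  L1_Linfty u0 -> L1_Linfty v0 ->
  source_condition T f -> source_condition T g ->
  admissible T J t nu1 nu2 phi1 phi2 u0 v0 f g ->
  ae_solution J t nu1 nu2 phi1 phi2 u0 f U ->
  ae_solution J t nu1 nu2 phi1 phi2 v0 g V ->
  forall j, (1 <= j <= J)%N ->
  (\int[lebesgue_rV R N]_x (Num.max (U j x - V j x) 0)%:E <=
   \int[lebesgue_rV R N]_x (Num.max (u0 x - v0 x) 0)%:E +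
   \int[lebesgue_measure]_(s in `]0%R, t j[)
     \int[lebesgue_rV R N]_x (Num.max (f (x, s) - g (x, s)) 0)%:E)%E.
Proof.
move=> T0 grid Lu0 Lv0 srcf srcg adm solU solV j /andP[_ jJ].
case: adm; set M := fine _ => _ [hphi1 cphi1] [hphi2 lphi2] cfl.
have bounds0 (u : 'rV[R]_N -> R) k : (0 <= data_bound T u k)%E.
  apply: adde_ge0; first exact: Lnorm_ge0.
  by apply: integral_ge0 => s _; exact: Lnorm_ge0.
have Mfin : maxe (data_bound T u0 f) (data_bound T v0 g) \is a fin_num.
  rewrite ge0_fin_numE; first by rewrite gt_max !data_bound_lty.
  by rewrite le_max bounds0.
have fM : (data_bound T u0 f <= M%:E)%E by rewrite fineK// le_max lexx.
have gM : (data_bound T v0 g <= M%:E)%E by rewrite fineK// le_max lexx orbT.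
have M0 : 0 <= M by rewrite -lee_fin (le_trans (bounds0 _ _) fM).
rewrite -data_bound_extension in fM; rewrite -data_bound_extension in gM.
(* The CFL condition involves the largest time step; as the Lipschitz constant and the mass are
   nonnegative, it passes to each single step. *)
have cfl' i : (i < J)%N -> forall r s, - M <= r -> r <= s -> s <= M ->
    r - time_step t i.+1 * fine (nu2 setT) * phi2 r <=
    s - time_step t i.+1 * fine (nu2 setT) * phi2 s.
  move=> iJ; apply: cfl_monotone => //.
    by rewrite mulr_ge0 ?fine_ge0// ltW// (time_step_gt0 grid).
  apply: le_trans cfl; rewrite mulrAC ler_wpM2r ?fine_ge0//.
  by rewrite ler_wpM2r ?lipschitz_constant_ge0// time_step_le_max.
have := ae_solution_contraction grid hphi1 cphi1 hphi2 cfl'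
  (L1_Linfty_measurable Lu0) (L1_Linfty_measurable Lv0)
  (measurable_source_extension srcf) (measurable_source_extension srcg)
  (source_extension_L1_lty srcf) (source_extension_L1_lty srcg) fM gM
  (ae_solution_extension grid solU) (ae_solution_extension grid solV) jJ.
(* Only times in []0, t j[], inside []0, T[], are involved, where the extended sources agree with
   [f] and [g]. *)
congr (_ <= _ + _)%E; apply: eq_integral => s; rewrite inE => sj.
apply: eq_integral => x _; rewrite !patchE mem_set//; split => //=.
by move: sj; apply: subset_itvl; rewrite bnd_simp (time_grid_le_T grid).
Qed.
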